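(* Let $X_i=\mu+\sigma_ie_i$, $i=1,\ldots,n$, be a modulated stationary process for which the strong invariance principle holds with $\Delta_n=n^{1/4}\log(n)$, i.e. there are standard Brownian motions $\{B_t\}$, $\{B_t^*\}$ with $$\max_{1\le i\le n}|S_i-\tau B_i|=o_{\mathrm{a.s.}}(\Delta_n)\quad\text{and}\quad \max_{1\le i\le n}|S_i^*-\tau^*B_i^*|=o_{\mathrm{a.s.}}(\Delta_n).$$ Let $k_n$ be the block length, $\ell_n=\lfloor n/k_n\rfloor$, and let $$\hat\tau^2=\frac1{\ell_n}\sum_{j=1}^{\ell_n}D_j^2,\qquad D_j=\frac{k_n[\bar X(j)-\bar X]}{V(j)}.$$ Define $$M_n=\frac1{k_n}+\max_{1\le j\le\ell_n}\frac{\Sigma^{*2}(j)+r^*(j)\Delta_n}{\Sigma^2(j)}+\max_{1\le j\le\ell_n}\frac{r(j)\Delta_n}{\Sigma(j)}.$$ Assume that $r_n\Delta_n/\Sigma_n\to0$ and $$\chi_n=\ell_n^{-1/2}+\log(n)M_n+\sqrt{\log(n)}\,\frac{\Sigma_n}{\ell_n^2}\sum_{j=1}^{\ell_n}\frac1{\Sigma(j)}+\frac{\Sigma_n^2}{\ell_n^3}\sum_{j=1}^{\ell_n}\frac1{\Sigma^2(j)}\to0.$$ Then $\hat\tau^2-\tau^2=O_{\mathrm{p}}(\chi_n)$. Consequently, $\hat\tau$ is a consistent estimate of $\tau$.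
   Context: Setting: $\{e_i\}$ is a stationary time series with $E(e_i)=0$, $E(e_i^2)=1$; $\mu\in\mathbb{R}$ is a constant; $\sigma_i>0$ are deterministic constants (which may depend on $n$). $S_i=\sum_{j=1}^ie_j$, $S_i^*=\sum_{j=1}^i(e_j^2-1)$. $\tau^2$ and $\tau^{*2}$ are the long-run variances of $\{e_i\}$ and $\{e_i^2-1\}$ (assumed well defined), where the long-run variance of a stationary process with autocovariances $\gamma_k$ is $\gamma_0+2\sum_{k\ge1}\gamma_k$; it is assumed that $\tau^2>0$, and $\tau>0$, $\tau^*\ge0$ are the square roots. Strong invariance principles are understood on a possibly enlarged probability space on which the process is redefined without changing its distribution; the two Brownian motions may be defined on different probability spaces. Notation: $\bar X=n^{-1}\sum_{i=1}^nX_i$; blocks $\mathcal{I}_j=\{(j-1)k_n+1,\ldots,jk_n\}$, $j=1,\ldots,\ell_n$; $\bar X(j)=k_n^{-1}\sum_{i\in\mathcal{I}_j}X_i$, $V^2(j)=\sum_{i\in\mathcal{I}_j}[X_i-\bar X(j)]^2$. $r_n=|\sigma_n|+\sum_{i=2}^n|\sigma_i-\sigma_{i-1}|$, $\Sigma_n^2=\sum_{i=1}^n\sigma_i^2$. On block $j$: $r(j)=|\sigma_{jk_n}|+\sum_{i\in\mathcal{I}_j}|\sigma_i-\sigma_{i-1}|$, $r^*(j)=|\sigma_{jk_n}^2|+\sum_{i\in\mathcal{I}_j}|\sigma_i^2-\sigma_{i-1}^2|$ (with the convention $\sigma_0=\sigma_1$), $\Sigma^2(j)=\sum_{i\in\mathcal{I}_j}\sigma_i^2$,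 $\Sigma^{*2}(j)=\bigl(\sum_{i\in\mathcal{I}_j}\sigma_i^4\bigr)^{1/2}$. *)

(* Defs.v *)
From HB Require Import structures.
From mathcomp Require Import all_boot all_order all_algebra.
From mathcomp Require Import all_classical all_reals all_analysis.
Set Implicit Arguments.
Unset Strict Implicit.
Unset Printing Implicit Defensive.
Import Order.TTheory GRing.Theory Num.Theory.
Import numFieldNormedType.Exports.
Local Open Scope classical_set_scope.
Local Open Scope ring_scope.

(* A real-valued time series is a sequence x : nat -> T -> R of functions on
   the sample space, indexed from 1: the value x 0 is never used. *)

Section processes.
Context {R : realType}.

(* (x_{h+1}, ..., x_{h+n}) *)
Definition window d (T : measurableType d) (x : nat -> T -> R) (h n : nat) :
  T -> n.-tuple R := fun w => [tuple x (h + i).+1 w | i < n].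

Definition strictly_stationary d (T : measurableType d) (P : probability T R)
    (x : nat -> T -> R) : Prop :=
  forall (h n : nat) (A : set (n.-tuple R)), measurable A ->
    P (window x h n @^-1` A) = P (window x 0 n @^-1` A).

Definition same_law d (T : measurableType d) (P : probability T R)
    (x : nat -> T -> R) d' (T' : measurableType d') (P' : probability T' R)
    (x' : nat -> T' -> R) : Prop :=
  forall (n : nat) (A : set (n.-tuple R)), measurable A ->
    P (window x 0 n @^-1` A) = P' (window x' 0 n @^-1` A).

Definition autocov d (T : measurableType d) (P : probability T R)
    (x : nat -> T -> R) (h : nat) : R :=
  fine (covariance P (x 1%N) (x h.+1)).

(* The long-run variance of x is well defined and equal to v.  Since
   autocov is read through fine, square integrability is required here. *)
Definition has_long_run_variance d (T : measurableType d)
    (P : probability T R) (x : nat -> T -> R) (v : R) : Prop :=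
  (forall i, (0 < i)%N -> x i \in Lfun P 2%:E) /\
  (fun m : nat => autocov P x 0 + 2 * \sum_(1 <= h < m.+1) autocov P x h)
    @ \oo --> v.

(* Taking some of the A i equal to setT gives the product rule for every
   subfamily. *)
Definition mutually_independent d (T : measurableType d)
    (P : probability T R) (n : nat) (Y : 'I_n -> T -> R) : Prop :=
  forall A : 'I_n -> set R, (forall i, measurable (A i)) ->
    P (\bigcap_i (Y i @^-1` A i)) = (\prod_(i < n) P (Y i @^-1` A i))%E.

(* Only the values B t with 0 <= t are constrained.  The second parameter of
   normal_prob is the standard deviation. *)
Definition standard_brownian_motion d (T : measurableType d)
    (P : probability T R) (B : R -> T -> R) : Prop :=
  [/\ forall t, 0 <= t -> measurable_fun [set: T] (B t),
      {ae P, forall w, B 0 w = 0},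
      forall (n : nat) (t : nat -> R), 0 <= t 0%N ->
        {homo t : i j / (i <= j)%N >-> i <= j} ->
        mutually_independent P
          (fun (i : 'I_n) w => B (t i.+1) w - B (t i) w),
      forall s t, 0 <= s -> s < t -> forall A : set R, measurable A ->
        P ((fun w => B t w - B s w) @^-1` A) =
        normal_prob 0 (Num.sqrt (t - s)) A
    & {ae P, forall w, {within `[0, +oo[%classic, continuous (B ^~ w)}}].

(* The strong invariance principle for x with rate Delta:
   max_{1 <= i <= n} |y_1 + ... + y_i - v B_i| = o_as(Delta n) for a copy y of
   the process x and a Brownian motion B, both living on some probability
   space, possibly different from that of x. *)
Definition strong_invariance_principle d (T : measurableType d)
    (P : probability T R) (x : nat -> T -> R) (v : R) (Delta : nat -> R) :
    Prop :=
  exists (d' : measure_display) (T' : measurableType d')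
         (P' : probability T' R) (y : nat -> T' -> R) (B : R -> T' -> R),
  [/\ forall i, (0 < i)%N -> measurable_fun [set: T'] (y i),
      same_law P x P' y,
      standard_brownian_motion P' B
    & {ae P', forall w,
        (fun n : nat =>
           (\big[Num.max/0]_(1 <= i < n.+1)
              `|\sum_(1 <= j < i.+1) y j w - v * B i%:R w|) / Delta n)
        @ \oo --> (0 : R)}].

Definition bounded_in_probability d (T : measurableType d)
    (P : probability T R) (Z : nat -> T -> R) (a : nat -> R) : Prop :=
  forall eps : R, 0 < eps -> exists C : R, 0 < C /\
    \forall n \near \oo,
      (P [set w | (C * `|a n| < `|Z n w|)%R] <= eps%:E)%E.

Definition cvg_in_probability d (T : measurableType d)
    (P : probability T R) (Z : nat -> T -> R) (z : R) : Prop :=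
  forall eps : R, 0 < eps ->
    (fun n => P [set w | eps < `|Z n w - z|]) @ \oo --> 0%E.

End processes.

Section block_quantities.
Context {R : realType}.
Implicit Types (n k j : nat) (x s : nat -> R) (Delta : R).

Definition sip_rate n : R := n%:R `^ (4^-1) * ln n%:R.

(* The sum of F over the block I_j = {(j-1)k+1, ..., jk}, for j >= 1. *)
Definition block_sum k j (F : nat -> R) : R :=
  \sum_((j.-1 * k).+1 <= i < (j * k).+1) F i.

Definition nblocks n k : nat := (n %/ k)%N.

(* Only used for non-negative F, so that starting from 0 is harmless. *)
Definition max_blocks n k (F : nat -> R) : R :=
  \big[Num.max/0]_(1 <= j < (nblocks n k).+1) F j.

Definition sample_mean n x : R := n%:R^-1 * \sum_(1 <= i < n.+1) x i.

Definition block_mean k x j : R := k%:R^-1 * block_sum k j x.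

Definition block_V k x j : R :=
  Num.sqrt (block_sum k j (fun i => (x i - block_mean k x j) ^+ 2)).

(* If block_V is 0 then block_D is 0, by the convention 0^-1 = 0. *)
Definition block_D n k x j : R :=
  k%:R * (block_mean k x j - sample_mean n x) / block_V k x j.

Definition tau2_hat n k x : R :=
  (nblocks n k)%:R^-1 *
  \sum_(1 <= j < (nblocks n k).+1) block_D n k x j ^+ 2.

Definition tau_hat n k x : R := Num.sqrt (tau2_hat n k x).

Definition total_r n s : R := `|s n| + \sum_(2 <= i < n.+1) `|s i - s i.-1|.

Definition total_Sigma n s : R := Num.sqrt (\sum_(1 <= i < n.+1) s i ^+ 2).

(* s_{i-1}, with the convention s_0 = s_1 *)
Definition prev s i : R := s (maxn i.-1 1).

Definition block_r k s j : R :=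
  `|s (j * k)%N| + block_sum k j (fun i => `|s i - prev s i|).

Definition block_rstar k s j : R :=
  `|s (j * k)%N ^+ 2| + block_sum k j (fun i => `|s i ^+ 2 - prev s i ^+ 2|).

Definition block_Sigma k s j : R :=
  Num.sqrt (block_sum k j (fun i => s i ^+ 2)).

(* This is Sigma^{*2}(j), not its square root. *)
Definition block_Sigmastar2 k s j : R :=
  Num.sqrt (block_sum k j (fun i => s i ^+ 4)).

Definition M_rate n k s Delta : R :=
  k%:R^-1
  + max_blocks n k (fun j =>
      (block_Sigmastar2 k s j + block_rstar k s j * Delta)
        / block_Sigma k s j ^+ 2)
  + max_blocks n k (fun j => block_r k s j * Delta / block_Sigma k s j).

Definition chi_rate n k s Delta : R :=
  let l := nblocks n k in
  (Num.sqrt l%:R)^-1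
  + ln n%:R * M_rate n k s Delta
  + Num.sqrt (ln n%:R) * (total_Sigma n s / l%:R ^+ 2)
      * (\sum_(1 <= j < l.+1) (block_Sigma k s j)^-1)
  + total_Sigma n s ^+ 2 / l%:R ^+ 3
      * (\sum_(1 <= j < l.+1) (block_Sigma k s j ^+ 2)^-1).

End block_quantities.

(* Main.v *)
Require Import Defs.
From HB Require Import structures.
From mathcomp Require Import all_boot all_order all_algebra.
From mathcomp Require Import all_classical all_reals all_analysis.
From mathcomp Require Import measurable_realfun ring lra.
Import Order.TTheory GRing.Theory Num.Theory.
Import numFieldNormedType.Exports.
Local Open Scope classical_set_scope.
Local Open Scope ring_scope.

(**
Let A_j be the sum of sigma_i e_i over block j and A the sum over all i <= n.
Subtracting means removes mu and gives D_j = (A_j - (k/n) A) / V(j).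

Numerators.  By the first invariance principle the partial sums of e are
uniformly within Delta_n of those of tau Z_i, where Z_i = B_i - B_(i-1).
Summation by parts turns this into
A_j / Sigma(j) = tau g_j + O(r(j) Delta_n / Sigma(j)), where g_j is the
normalised sum of sigma_i Z_i over block j ([block_abel_bound]).  The g_j are
independent standard normal variables, so the mean of the g_j^2 over the blocks
is 1 + O_p(1 / sqrt l), and max g_j^2 = O_p(log n)
([gaussian_blocks_event]).  Likewise A = O_p(Sigma_n), because
r_n Delta_n / Sigma_n tends to 0, so that subtracting (k/n) A, where k/n <= 1/l,
costs the last two terms of chi_n once the square is expanded
([good_sums_of_approx]).

Denominators.  V(j)^2 / Sigma(j)^2 differs from 1 by the block sum of
sigma_i^2 (e_i^2 - 1) divided by Sigma(j)^2, and by (A_j / Sigma(j))^2 / k.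
The second invariance principle bounds the former, and the maximum of the g_j^2
the latter, by O_p(log(n) M_n) uniformly in j ([good_squares_of_approx]).
Replacing V(j) by Sigma(j) therefore multiplies the mean of the squares by
1 + O_p(chi_n) ([tau2_hat_close]).

The two Brownian motions may live on different probability spaces, so the two
approximations need not hold jointly.  Each of them is used only to show that an
event about finitely many values of the noise ([good_sums], [good_squares]) is
likely.  The law of the copied process being that of the original one, the same
events are likely on the original space ([same_law_event]), where they can be
intersected and combined by a deterministic computation.

All that is used about the increments is the formula
E exp(sum c_i Z_i) = exp(sum c_i^2 / 2) for their linear combinations
([gaussian_sequence]).  It stands in for the joint normality of weighted sums:
moments, decorrelation of squares and tails are read off from
E cosh(l Y) = exp(l^2 / 2) by letting the parameter l vary.

Consistency follows since |sqrt a - tau| <= |a - tau^2| / tau for a >= 0.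
*)

Set Implicit Arguments.
Unset Strict Implicit.
Unset Printing Implicit Defensive.

(** * Independent variables and the normal moment generating function *)

Section weighted_law.
Context d (T : measurableType d) d' (U : measurableType d') (R : realType).
Variables (m : {measure set T -> \bar R}) (q : {measure set U -> \bar R}).

Import HBNNSimple.

(** Measures that agree on indicators agree on non-negative functions, for the
    measure with density W pushed forward by Z and for c times q.  With Z the
    identity this integrates against a density; with W a product of functions of
    other variables it adds one factor to a product formula. *)
Lemma weighted_law_integral (W : T -> R) (Z : T -> U) (c : R) :
  measurable_fun setT W -> (forall w, 0 <= W w) -> measurable_fun setT Z ->
  0 <= c ->
  (forall A, measurable A ->
    (\int[m]_w (W w * \1_A (Z w))%:E = c%:E * q A)%E) ->
  forall f : U -> R, measurable_fun setT f -> (forall x, 0 <= f x) ->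
    (\int[m]_w (W w * f (Z w))%:E = c%:E * \int[q]_x (f x)%:E)%E.
Proof.
move=> mW W0 mZ c0 WA f mf f0.
have mf1 : measurable_fun setT (EFin \o f) by exact/measurable_EFinP.
pose g := nnsfun_approx measurableT mf1.
have mgZ n : measurable_fun setT (fun w => g n (Z w)) by exact: measurableT_comp.
have gcvg x : (g n x)%:E @[n --> \oo] --> (f x)%:E.
  have fge0 y : setT y -> (0 <= (EFin \o f) y)%E by rewrite lee_fin.
  exact: (cvg_nnsfun_approx measurableT mf1 fge0 (x := x) I).
have level_ge0 n y (r : R) z : 0 <= r -> 0 <= y * (r * \1_(g n @^-1` [set y]) z).
  move=> r0; have [y0|y0] := leP 0 y; first by rewrite !mulr_ge0.
  by rewrite preimage_nnfun0// indicE/= in_set0/= !mulr0.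
(* both sides are reduced to the level sets of the simple function g n *)
have simple d1 (V : measurableType d1) (mu : {measure set V -> \bar R})
    (r : V -> R) (h : V -> U) n : measurable_fun setT r -> (forall v, 0 <= r v) ->
    measurable_fun setT h ->
    (\int[mu]_v (r v * g n (h v))%:E =
    \sum_(y \in range (g n))
       \int[mu]_v (y * (r v * \1_(g n @^-1` [set y]) (h v)))%:E)%E.
  move=> mr r0 mh; rewrite -ge0_integral_fsum//; last first.
  - by move=> y v _; rewrite lee_fin level_ge0.
  - move=> y; apply/measurable_EFinP/measurable_funM => //.
    apply: measurable_funM => //; apply: (measurableT_comp _ mh).
    exact: measurable_indic.
  apply: eq_integral => v _; rewrite fimfunE mulr_fsumr -fsumEFin//.
  by apply: eq_fsbigr => y _; rewrite mulrCA.
have step n : (\int[m]_w (W w * g n (Z w))%:E = c%:E * \int[q]_x (g n x)%:E)%E.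
  rewrite simple//.
  under [in RHS]eq_integral do rewrite -[g n _]mul1r.
  rewrite (simple _ _ q (cst 1) id)// ge0_mule_fsumr; last first.
    by move=> y; apply: integral_ge0 => x _; rewrite lee_fin level_ge0.
  apply: eq_fsbigr => y _; have [y0|y0] := leP 0 y; last first.
    by rewrite !integral0_eq ?mule0//= => w _;
      rewrite preimage_nnfun0// indicE/= in_set0/= !mulr0.
  have mA : measurable (g n @^-1` [set y]) by [].
  under eq_integral do rewrite EFinM.
  rewrite ge0_integralZl//; last 2 first.
  - apply/measurable_EFinP; apply: measurable_funM => //.
    by apply: (measurableT_comp _ mZ); exact: measurable_indic.
  - by move=> w _; rewrite lee_fin mulr_ge0.
  rewrite WA//; under [in RHS]eq_integral do rewrite mul1r EFinM.
  rewrite ge0_integralZl//; last exact/measurable_EFinP/measurable_indic.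
  by rewrite muleCA integral_indic// setIT.
have L1 : (\int[m]_w (W w * g n (Z w))%:E @[n --> \oo] -->
    \int[m]_w (W w * f (Z w))%:E)%E.
  rewrite (_ : (\int[m]_w (W w * f (Z w))%:E)%E =
      (\int[m]_w limn (fun n => (W w * g n (Z w))%:E))%E).
    apply: cvg_monotone_convergence => //.
    - by move=> n; apply/measurable_EFinP/measurable_funM.
    - by move=> n w _; rewrite lee_fin mulr_ge0.
    - move=> w _ i j ij; rewrite lee_fin ler_wpM2l//.
      exact/lefP/nd_nnsfun_approx.
  apply: eq_integral => w _; apply/esym/cvg_lim => //.
  by under eq_fun do rewrite EFinM; rewrite EFinM; exact: cvgeZl.
have L2 : (\int[q]_x (g n x)%:E @[n --> \oo] --> \int[q]_x (f x)%:E)%E.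
  rewrite (_ : (\int[q]_x (f x)%:E)%E = (\int[q]_x limn (fun n => (g n x)%:E))%E).
    apply: cvg_monotone_convergence => //.
    - by move=> n; apply/measurable_EFinP.
    - by move=> n w _; rewrite lee_fin.
    - by move=> w _ i j ij; rewrite lee_fin; exact/lefP/nd_nnsfun_approx.
  by apply: eq_integral => w _; apply/esym/cvg_lim.
move: L1; under eq_fun do rewrite step.
by move=> /cvg_lim <- //; apply/cvg_lim => //; exact: cvgeZl.
Qed.

End weighted_law.

Lemma prod_indic_bigcap (R : realType) T n (A : 'I_n -> set T) (w : T) :
  \prod_(i < n) \1_(A i) w = \1_(\bigcap_i A i) w :> R.
Proof.
rewrite [RHS]indicE; case: (pselect ((\bigcap_i A i) w)) => Aw.
  rewrite (mem_set Aw) big1// => i _.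
  by rewrite indicE mem_set//; apply: Aw.
rewrite memNset//=.
have [i Ai] : exists i, ~ A i w by apply/existsNP => H; apply: Aw => i _; exact: H.
by rewrite (bigD1 i)//= indicE memNset// mul0r.
Qed.

Section independent.
Context d (T : measurableType d) (R : realType) (P : probability T R).

(** Independence is the case where every f i is an indicator.  The indicators are
    replaced by arbitrary functions one index at a time, the other factors
    serving as a weight. *)
Lemma mutually_independent_integral_prod n (Y : 'I_n -> T -> R)
    (q : 'I_n -> {measure set (measurableTypeR R) -> \bar R})
    (f : 'I_n -> R -> R) (m : 'I_n -> R) :
  (forall i, measurable_fun setT (Y i)) -> mutually_independent P Y ->
  (forall i (A : set R), measurable A -> P (Y i @^-1` A) = q i A) ->
  (forall i, measurable_fun setT (f i)) -> (forall i x, 0 <= f i x) ->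
  (forall i, (\int[q i]_x (f i x)%:E = (m i)%:E)%E) ->
  (\int[P]_w (\prod_(i < n) f i (Y i w))%:E = (\prod_(i < n) m i)%:E)%E.
Proof.
move=> mY indY lawY mf f0 fm.
(* the first k factors are the f i, the others indicators of measurable sets *)
suff H k : (k <= n)%N -> forall A : 'I_n -> set R, (forall i, measurable (A i)) ->
    let h (i : 'I_n) := if (i < k)%N then f i else \1_(A i) in
    let p (i : 'I_n) := if (i < k)%N then m i else fine (P (Y i @^-1` A i)) in
    (\int[P]_w (\prod_(i < n) h i (Y i w))%:E = (\prod_(i < n) p i)%:E)%E.
  have := H n (leqnn n) (fun=> setT) (fun=> measurableT) => /=.
  under eq_integral do (under eq_bigr do rewrite ltn_ord).
  by under [in RHS]eq_bigr do rewrite ltn_ord.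
have mYA i (A : set R) : measurable A -> measurable (Y i @^-1` A).
  by move=> mA; rewrite -[X in measurable X]setTI; exact: mY.
elim: k => [_ A mA|k IH kn A mA] /=.
  rewrite (eq_integral (fun w => (\1_(\bigcap_i (Y i @^-1` A i)) w)%:E)); last first.
    by move=> w _; rewrite -prod_indic_bigcap.
  rewrite integral_indic//; last by apply: fin_bigcap_measurable => // i _; exact: mYA.
  rewrite setIT; apply: etrans (indY A mA) _; rewrite -prodEFin; apply: eq_bigr => i _.
  by rewrite fineK// fin_num_measure//; exact: mYA.
pose i0 := Ordinal kn.
pose h (i : 'I_n) := if (i < k.+1)%N then f i else \1_(A i).
pose p (i : 'I_n) := if (i < k.+1)%N then m i else fine (P (Y i @^-1` A i)).
have mh i : measurable_fun setT (h i).
  by rewrite /h; case: ifP => // _; exact: measurable_indic.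
have h0 i x : 0 <= h i x by rewrite /h; case: ifP.
have p0 i : 0 <= p i.
  rewrite /p; case: ifP => _; last exact: fine_ge0.
  by rewrite -lee_fin -fm; apply: integral_ge0 => w _; rewrite lee_fin.
rewrite (eq_integral (fun w =>
  ((\prod_(i < n | i != i0) h i (Y i w)) * f i0 (Y i0 w))%:E)); last first.
  by move=> w _; rewrite (bigD1 i0)//= ltnSn mulrC.
rewrite (@weighted_law_integral _ _ _ _ _ _ (q i0) _ _ (\prod_(i < n | i != i0) p i))//.
- by rewrite fm -EFinM mulrC [in RHS](bigD1 i0)//= ltnSn.
- under eq_fun do rewrite -big_filter.
  by apply: measurable_prod => i _; apply: measurableT_comp.
- by move=> w; apply: prodr_ge0.
- exact: mY.
- exact: prodr_ge0.
- (* q lives on another display of R, with the same measurable sets *)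
  move=> B mB0; have mB : measurable (B : set R) := mB0.
  pose A' i : set R := if i == i0 then B else A i.
  have mA' i : measurable (A' i) by rewrite /A'; case: ifP.
  have := IH (ltnW kn) A' mA' => /=.
  have ltkS i : i != i0 -> (i < k.+1)%N = (i < k)%N.
    move=> ii; rewrite ltnS leq_eqVlt; case: eqP => // ik.
    by case/eqP: ii; apply: val_inj.
  rewrite (eq_integral (fun w =>
    ((\prod_(i < n | i != i0) h i (Y i w)) * \1_B (Y i0 w))%:E)); last first.
    move=> w _; rewrite (bigD1 i0)//= ltnn /A' eqxx mulrC; congr (_ * _)%:E.
    by apply: eq_bigr => i ii; rewrite /h ltkS// (negbTE ii).
  move=> ->; rewrite (bigD1 i0)//= ltnn /A' eqxx EFinM muleC; congr (_ * _)%E.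
    by congr (_%:E); apply: eq_bigr => i ii; rewrite /p ltkS// (negbTE ii).
  by rewrite fineK ?lawY// -lawY// fin_num_measure//; exact: mYA.
- exact: mf.
Qed.

End independent.

Lemma normal_prob_indic (R : realType) (m s : R) (A : set R) :
  (\int[lebesgue_measure]_x (normal_pdf m s x * \1_A x)%:E = normal_prob m s A)%E.
Proof.
rewrite /normal_prob [RHS]integral_mkcond; apply: eq_integral => x _.
by rewrite patchE indicE; case: ifP; rewrite ?mulr1 ?mulr0.
Qed.

(** Completing the square: exp(c x) times the density of N(0, 1) is exp(c^2 / 2)
    times the density of N(c, 1). *)
Lemma normal_prob_mgf (R : realType) (c : R) :
  (\int[normal_prob (0:R) 1]_x (expR (c * x))%:E = (expR (c ^+ 2 / 2))%:E)%E.
Proof.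
have mpdf := measurable_normal_pdf (0:R) 1.
have mexp : measurable_fun setT (fun x : R => expR (c * x)).
  by apply: measurableT_comp => //; exact: measurable_funM.
have -> : (\int[normal_prob (0:R) 1]_x (expR (c * x))%:E =
    1%:E * \int[normal_prob (0:R) 1]_x (expR (c * x))%:E)%E by rewrite mul1e.
rewrite -(@weighted_law_integral _ _ _ _ _ lebesgue_measure _ (normal_pdf (0:R) 1) id)//.
- transitivity (\int[lebesgue_measure]_x ((expR (c ^+ 2 / 2))%:E * (normal_pdf c 1 x)%:E))%E.
    apply: eq_integral => x _; rewrite -EFinM !normal_pdfE// mulrCA -mulrA -!expRD.
    by congr (_ * expR _)%:E; rewrite subr0 expr1n; field.
  rewrite ge0_integralZl//; last 2 first.
  - by apply/measurable_EFinP; exact: measurable_normal_pdf.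
  - by move=> x _; rewrite lee_fin normal_pdf_ge0.
  by rewrite integral_normal_pdf mule1.
- by move=> x; exact: normal_pdf_ge0.
- move=> A mA; rewrite mul1e; exact: normal_prob_indic.
Qed.

(** * Inequalities for the hyperbolic cosine *)

Section cosh.
Context {R : realType}.
Implicit Types u v l : R.

Definition cosh u : R := (expR u + expR (- u)) / 2.

Lemma coshN u : cosh (- u) = cosh u.
Proof. by rewrite /cosh opprK addrC. Qed.

Lemma cosh_half u : cosh u - 1 = (expR (u / 2) - expR (- (u / 2))) ^+ 2 / 2.
Proof.
have -> : cosh u = (expR (u / 2) ^+ 2 + expR (- (u / 2)) ^+ 2) / 2.
  by rewrite /cosh -!expRM_natl; congr ((expR _ + expR _) / 2); field.
have : expR (u / 2) * expR (- (u / 2)) = 1 by rewrite -expRD subrr expR0.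
set a := expR _; set b := expR _ => ab.
by rewrite sqrrB ab; field.
Qed.

(** The mean value theorem for sinh, whose derivative cosh lies between cosh 0
    and cosh v on [0, v]. *)
Lemma expR_sub_opp_bounds v : 0 <= v ->
  2 * v <= expR v - expR (- v) <= v * (expR v + expR (- v)).
Proof.
rewrite le_eqVlt => /predU1P[<-|v0]; first by rewrite oppr0 subrr !mulr0 mul0r lexx.
pose f x : R := expR x - expR (- x).
pose f' x : R := expR x + expR (- x).
have df (x : R) : is_derive x (1 : R) f (f' x).
  by rewrite /f; apply: is_derive_eq; rewrite /GRing.scale/= /f'; ring.
have [|c] := @MVT _ f f' 0 v v0 (fun x _ => df x).
  apply: derivable_within_continuous => x _.
  exact: (@ex_derive _ _ _ _ _ _ _ (df x)).
rewrite in_itv/= => /andP[/ltW c0 /ltW cv].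
rewrite /f oppr0 subrr !subr0 addr0 /f' => ->; rewrite (mulrC v) !ler_pM2r//.
have prod1 x : expR x * expR (- x) = 1 :> R by rewrite -expRD subrr expR0.
have ec := expR_gt0 c; have ec' := expR_gt0 (- c); have cc := prod1 c.
have ev := expR_gt0 v; have ev' := expR_gt0 (- v); have vv := prod1 v.
have cv' : expR c <= expR v by rewrite ler_expR.
have vc' : expR (- v) <= expR (- c) by rewrite ler_expR lerN2.
have ec1 : 1 <= expR c by rewrite -expR0 ler_expR.
apply/andP; split.
  have := sqr_ge0 (expR c - 1); nra.
have : (expR v - expR c) * (expR v - expR (- c)) >= 0.
  by rewrite mulr_ge0 ?subr_ge0// (le_trans _ cv')// ler_expR; lra.
(* x + 1/x is increasing on [1, +oo[, with x = expR c and x = expR v *)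
suff : (expR v + expR (- v) - (expR c + expR (- c))) * (expR c * expR v) =
   (expR v - expR c) * (expR c * expR v - 1).
  move=> E _; rewrite -[leLHS]/(expR c + expR (- c)) -subr_ge0.
  rewrite -(pmulr_lge0 _ (mulr_gt0 ec ev)) E.
  rewrite mulr_ge0 ?subr_ge0//; nra.
transitivity (expR v * expR c * expR v + expR v * expR (- v) * expR c
  - expR c * expR c * expR v - (expR c * expR (- c)) * expR v); first ring.
rewrite cc vv; ring.
Qed.

Lemma cosh_ge1 u : 1 <= cosh u.
Proof. by rewrite -subr_ge0 cosh_half divr_ge0// sqr_ge0. Qed.

(** Since cosh u - 1 = 2 sinh(u/2)^2, this is the square of the bounds on sinh.
    The constant 1/2 must be exact on both sides: it yields the exact second
    moments. *)
Lemma cosh_bounds u : u ^+ 2 / 2 <= cosh u - 1 <= u ^+ 2 / 2 * cosh u.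
Proof.
wlog u0 : u / 0 <= u.
  move=> H; have [/H//|/ltW u0] := leP 0 u.
  by rewrite -coshN -(sqrrN u); apply: H; rewrite oppr_ge0.
have v0 : 0 <= u / 2 by rewrite divr_ge0.
have /andP[lo hi] := expR_sub_opp_bounds v0.
have sumE : (expR (u / 2) + expR (- (u / 2))) ^+ 2 = 2 * cosh u + 2.
  have : cosh u = 1 + (cosh u - 1) by ring.
  rewrite cosh_half.
  have : expR (u / 2) * expR (- (u / 2)) = 1 by rewrite -expRD subrr expR0.
  set a := expR _; set b := expR _ => ab ->.
  have -> : (a + b) ^+ 2 = (a - b) ^+ 2 + 4 * (a * b) by ring.
  by rewrite ab; field.
have c1 := cosh_ge1 u.
rewrite cosh_half; apply/andP; split.
  rewrite ler_pM2r ?invr_gt0// ler_sqr ?nnegrE; lra.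
have : (expR (u / 2) - expR (- (u / 2))) ^+ 2 <=
       (u / 2 * (expR (u / 2) + expR (- (u / 2)))) ^+ 2.
  by rewrite ler_sqr ?nnegrE; lra.
rewrite exprMn sumE; have := sqr_ge0 u; nra.
Qed.

(** The function cosh - 1 is convex and vanishes at 0. *)
Lemma cosh_scale_le l u : 0 <= l <= 1 -> cosh (l * u) - 1 <= l * (cosh u - 1).
Proof.
move=> /andP[l0 l1].
have cvx x : expR (l * x) <= l * expR x + (1 - l).
  have /= := @convex_expR R (Itv01 l0 l1) x 0.
  rewrite !convRE /= expR0 /unstable.onem !mulr0 addr0 mulr1.
  exact.
have := cvx u; have := cvx (- u); rewrite mulrN /cosh; lra.
Qed.

Lemma cosh_sqr_le u : (cosh u - 1) ^+ 2 <= cosh (2 * u).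
Proof.
have c1 := cosh_ge1 u.
have -> : cosh (2 * u) = 2 * cosh u ^+ 2 - 1.
  have : expR u * expR (- u) = 1 by rewrite -expRD subrr expR0.
  rewrite /cosh -mulrN !expRM_natl; set a := expR _; set b := expR _ => ab.
  have -> : 2 * ((a + b) / 2) ^+ 2 - 1 = (a ^+ 2 + b ^+ 2) / 2 + (a * b) - 1 by field.
  by rewrite ab; ring.
nra.
Qed.

Lemma coshM u v : cosh u * cosh v = (cosh (u + v) + cosh (u - v)) / 2.
Proof.
rewrite /cosh opprD opprB !expRD !expRN; field.
by rewrite !gt_eqF ?expR_gt0.
Qed.

End cosh.

(** * Expectations of non-negative functions and Gaussian sequences *)

Section nonneg_mean.
Context d (T : measurableType d) (R : realType) (P : probability T R).
Implicit Types (f g : T -> R) (a b k t : R).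

(** Recording measurability, sign and finiteness together with the value lets
    expectations be added and compared as real numbers. *)
Definition nonneg_mean f a : Prop :=
  [/\ measurable_fun setT f, forall w, 0 <= f w
    & (\int[P]_w (f w)%:E = a%:E)%E].

Lemma nonneg_mean_cst k : 0 <= k -> nonneg_mean (fun=> k) k.
Proof.
move=> k0; split => //.
by rewrite integral_cst//= probability_setT mule1.
Qed.

Lemma nonneg_meanD f g a b :
  nonneg_mean f a -> nonneg_mean g b -> nonneg_mean (fun w => f w + g w) (a + b).
Proof.
move=> [mf f0 fa] [mg g0 gb]; split.
- exact: measurable_funD.
- by move=> w; rewrite addr_ge0.
- under eq_integral do rewrite EFinD.
  by rewrite ge0_integralD// ?fa ?gb//; try exact/measurable_EFinP;
    move=> w _; rewrite lee_fin.
Qed.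

Lemma nonneg_meanZ k f a :
  0 <= k -> nonneg_mean f a -> nonneg_mean (fun w => k * f w) (k * a).
Proof.
move=> k0 [mf f0 fa]; split.
- exact: measurable_funM.
- by move=> w; rewrite mulr_ge0.
- under eq_integral do rewrite EFinM.
  by rewrite ge0_integralZl// ?fa//; try exact/measurable_EFinP;
    move=> w _; rewrite lee_fin.
Qed.

Lemma nonneg_mean_sum (I : Type) (s : seq I) (Q : pred I) (f : I -> T -> R) (a : I -> R) :
  (forall i, Q i -> nonneg_mean (f i) (a i)) ->
  nonneg_mean (fun w => \sum_(i <- s | Q i) f i w) (\sum_(i <- s | Q i) a i).
Proof.
move=> fa; elim: s => [|i s IH].
  under eq_fun do rewrite big_nil.
  by rewrite big_nil; exact: nonneg_mean_cst.
under eq_fun do rewrite big_cons.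
by rewrite big_cons; case: ifP => // Qi; apply: nonneg_meanD => //; exact: fa.
Qed.

Lemma nonneg_mean_le f g a b : (forall w, f w <= g w) ->
  nonneg_mean f a -> nonneg_mean g b -> a <= b.
Proof.
move=> fg [mf f0 fa] [mg g0 gb].
rewrite -lee_fin -fa -gb; apply: ge0_le_integral => //; try exact/measurable_EFinP.
- by move=> w _; rewrite lee_fin.
- by move=> w _; rewrite lee_fin.
Qed.

Lemma nonneg_mean_dominated f g b : measurable_fun setT f ->
  (forall w, 0 <= f w <= g w) -> nonneg_mean g b ->
  exists2 a, nonneg_mean f a & a <= b.
Proof.
move=> mf fg gb; have [mg g0 gE] := gb.
have f0 w : 0 <= f w by case/andP: (fg w).
have fleg w : f w <= g w by case/andP: (fg w).
have le : (\int[P]_w (f w)%:E <= b%:E)%E.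
  rewrite -gE; apply: ge0_le_integral => //; try exact/measurable_EFinP.
  - by move=> w _; rewrite lee_fin.
  - by move=> w _; rewrite lee_fin.
have fin : (\int[P]_w (f w)%:E)%E \is a fin_num.
  rewrite ge0_fin_numE ?(le_lt_trans le) ?ltry//.
  by apply: integral_ge0 => w _; rewrite lee_fin.
exists (fine (\int[P]_w (f w)%:E)%E); first by split => //; rewrite fineK.
by rewrite -lee_fin fineK.
Qed.

Lemma measurable_le f t : measurable_fun setT f -> measurable [set w | t <= f w].
Proof.
move=> mf; rewrite (_ : [set w | _] = f @^-1` `[t, +oo[%classic).
  by rewrite -[X in measurable X]setTI; exact: mf.
by apply/seteqP; split => w /=; rewrite in_itv/= andbT.
Qed.

Lemma nonneg_mean_markov f a t : 0 < t -> nonneg_mean f a ->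
  (P [set w | (t <= f w)%R] <= (a / t)%:E)%E.
Proof.
move=> t0 fa; have [mf f0 fE] := fa.
have mS : measurable [set w | t <= f w] by exact: measurable_le.
have [b Ib ba] : exists2 b, nonneg_mean (\1_[set w | t <= f w]) b & b <= t^-1 * a.
  apply: (@nonneg_mean_dominated _ (fun w => t^-1 * f w)).
  - exact: measurable_indic.
  - move=> w; rewrite indicE; case: (boolP (w \in _)) => [|_].
      by rewrite inE/= => tf; rewrite ler01/= mulrC ler_pdivlMr// mul1r.
    by rewrite lexx/= mulr_ge0// invr_ge0 ltW.
  - by apply: nonneg_meanZ => //; rewrite invr_ge0 ltW.
move: Ib => [_ _]; rewrite integral_indic// setIT => ->.
by rewrite lee_fin mulrC.
Qed.

End nonneg_mean.

Section gaussian_sequence.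
Context d (T : measurableType d) (R : realType) (P : probability T R).
Implicit Types (Z : nat -> T -> R) (c : nat -> R) (n : nat).

(** Equivalent to the Z i, for i >= 1, being independent standard normal
    variables, in the form that linear combinations inherit at once. *)
Definition gaussian_sequence Z : Prop :=
  (forall i, measurable_fun setT (Z i)) /\
  forall n c,
    (\int[P]_w (expR (\sum_(1 <= i < n.+1) c i * Z i w))%:E =
     (expR ((\sum_(1 <= i < n.+1) c i ^+ 2) / 2))%:E)%E.

Lemma brownian_increments_gaussian (B : R -> T -> R) :
  standard_brownian_motion P B ->
  gaussian_sequence (fun i w => B i%:R w - B i.-1%:R w).
Proof.
move=> [mB _ indB lawB _]; have mBi i : measurable_fun setT (B i%:R) by exact: mB.
split=> [i|n c]; first exact: measurable_funB.
pose Y (i : 'I_n) w := B i.+1%:R w - B i%:R w.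
have := @mutually_independent_integral_prod _ _ _ P n Y
  (fun=> normal_prob (0 : R) 1) (fun i x => expR (c i.+1 * x))
  (fun i => expR (c i.+1 ^+ 2 / 2)).
rewrite -expR_sum big_add1 big_mkord -mulr_suml => <-//.
- apply: eq_integral => w _; rewrite big_add1 big_mkord -expR_sum.
  by congr (expR _)%:E.
- by move=> i; exact: measurable_funB.
- apply: (indB n (fun i => i%:R)) => // i j ij; by rewrite ler_nat.
- move=> i A mA; have := lawB i%:R i.+1%:R.
  rewrite -[X in Num.sqrt X](_ : 1 = _); last by rewrite -natrB// subSnn.
  by rewrite sqrtr1; apply => //; rewrite ltr_nat.
- move=> i; apply: measurableT_comp => //; exact: measurable_funM.
- by move=> i; exact: normal_prob_mgf.
Qed.

End gaussian_sequence.

(** * Moments and tails of Gaussian linear combinations *)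

Definition wsum (R : realType) T (Z : nat -> T -> R) n (c : nat -> R) (w : T) : R :=
  \sum_(1 <= i < n.+1) c i * Z i w.

Section gaussian_moments.
Context d (T : measurableType d) (R : realType) (P : probability T R).
Variable Z : nat -> T -> R.
Hypothesis gaussZ : gaussian_sequence P Z.
Implicit Types (c : nat -> R) (n : nat) (l t : R).

Lemma measurable_wsum n c : measurable_fun setT (wsum Z n c).
Proof.
by apply: measurable_sum => i; apply: measurable_funM => //; exact: gaussZ.1.
Qed.

Lemma nonneg_mean_expR n c :
  nonneg_mean P (fun w => expR (wsum Z n c w))
    (expR ((\sum_(1 <= i < n.+1) c i ^+ 2) / 2)).
Proof.
split; last exact: gaussZ.2.
- by apply: measurableT_comp => //; exact: measurable_wsum.
- by move=> w; exact: expR_ge0.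
Qed.

Lemma nonneg_mean_cosh n c l :
  nonneg_mean P (fun w => cosh (l * wsum Z n c w))
    (expR (l ^+ 2 * (\sum_(1 <= i < n.+1) c i ^+ 2) / 2)).
Proof.
have scale r : nonneg_mean P (fun w => expR (r * wsum Z n c w))
    (expR (r ^+ 2 * (\sum_(1 <= i < n.+1) c i ^+ 2) / 2)).
  have := nonneg_mean_expR n (fun i => r * c i).
  rewrite (_ : (fun w => _) = (fun w => expR (r * wsum Z n c w))).
    congr (nonneg_mean P _ (expR (_ / 2))).
    by rewrite mulr_sumr; apply: eq_bigr => i _; rewrite exprMn.
  apply/funext => w; congr expR; rewrite /wsum mulr_sumr.
  by apply: eq_bigr => i _; rewrite mulrA.
have := nonneg_meanZ (_ : 0 <= 2^-1 :> R) (nonneg_meanD (scale l) (scale (- l))).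
rewrite sqrrN invr_ge0 => /(_ (ler0n _ _)).
set a := expR _; have -> : 2^-1 * (a + a) = a by field.
rewrite (_ : (fun w => _) = (fun w => cosh (l * wsum Z n c w)))//.
by apply/funext => w; rewrite /cosh mulNr mulrC.
Qed.

(** From y^4 / 4 <= (cosh y - 1)^2 <= cosh (2 y). *)
Lemma nonneg_mean_exp4 n c : \sum_(1 <= i < n.+1) c i ^+ 2 = 1 ->
  exists2 a, nonneg_mean P (fun w => wsum Z n c w ^+ 4) a & a <= 4 * expR 2.
Proof.
move=> c1; have := nonneg_mean_cosh n c 2; rewrite c1 mulr1.
have -> : 2 ^+ 2 / 2 = 2 :> R by field.
move=> /(nonneg_meanZ (ler0n _ 4 : 0 <= 4 :> R)); apply: nonneg_mean_dominated.
  by apply: measurable_funX; exact: measurable_wsum.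
move=> w; rewrite exprn_even_ge0//=.
set y := wsum _ _ _ _.
have /andP[lo _] := cosh_bounds y; have := cosh_sqr_le y.
have : (y ^+ 2 / 2) ^+ 2 <= (cosh y - 1) ^+ 2.
  by rewrite ler_sqr ?nnegrE ?(le_trans _ lo)// divr_ge0// sqr_ge0.
have -> : (y ^+ 2 / 2) ^+ 2 = y ^+ 4 / 4 by field.
lra.
Qed.

(** The upper bound on cosh and convexity give, for 0 < l <= 1,
    1 + l^2/2 <= exp(l^2/2) = E cosh(l Y) <= 1 + l^2/2 E Y^2 + l^3 exp 2,
    whence the claim on dividing by l^2/2 and letting l tend to 0. *)
Lemma nonneg_mean_sqr_ge1 n c : \sum_(1 <= i < n.+1) c i ^+ 2 = 1 ->
  exists2 a, nonneg_mean P (fun w => wsum Z n c w ^+ 2) a & 1 <= a.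
Proof.
move=> c1.
have mc l : nonneg_mean P (fun w => cosh (l * wsum Z n c w)) (expR (l ^+ 2 / 2)).
  by have := nonneg_mean_cosh n c l; rewrite c1 mulr1.
have [||a Ya _] := @nonneg_mean_dominated _ _ _ P (fun w => wsum Z n c w ^+ 2)
    (fun w => 2 * cosh (1 * wsum Z n c w)) (2 * expR (1 ^+ 2 / 2)) _ _
    (nonneg_meanZ (ler0n _ 2) (mc 1)).
- by apply: measurable_funX; exact: measurable_wsum.
- move=> w; rewrite sqr_ge0/= mul1r.
  by have /andP[lo _] := cosh_bounds (wsum Z n c w); lra.
exists a => //; apply/ler_addgt0Pr => e e0.
have E0 : 0 < 2 * expR 2 :> R by rewrite mulr_gt0// expR_gt0.
(* the bound reads 1 <= a + 2 l exp 2, and this l makes the last term at most e *)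
pose l := Num.min 1 (e / (2 * expR 2)).
have l0 : 0 < l by rewrite lt_min ltr01 divr_gt0.
have l1 : l <= 1 by rewrite ge_min lexx.
have le : l * (2 * expR 2) <= e by rewrite -ler_pdivlMr// ge_min lexx orbT.
suff : 1 <= a + 2 * l * expR 2 by lra.
have := nonneg_mean_le _ (mc l)
  (nonneg_meanD (nonneg_meanD (nonneg_mean_cst P ler01)
     (nonneg_meanZ (_ : 0 <= l ^+ 2 / 2) Ya))
     (nonneg_meanZ (_ : 0 <= l ^+ 3) (mc 2))).
have -> : 2 ^+ 2 / 2 = 2 :> R by field.
have l2 : 0 <= l ^+ 2 / 2 by rewrite divr_ge0// sqr_ge0.
have l3 : 0 <= l ^+ 3 by rewrite exprn_ge0// ltW.
move=> /(_ _ l2 l3) H.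
have {H} : expR (l ^+ 2 / 2) <= 1 + l ^+ 2 / 2 * a + l ^+ 3 * expR 2.
  apply: H => w; set y := wsum _ _ _ _.
  have /andP[_ hi] := cosh_bounds (l * y).
  have /andP[lo _] := cosh_bounds y.
  have c2 := cosh_sqr_le y; have cy := cosh_ge1 y.
  have sc : cosh (l * y) - 1 <= l * (cosh y - 1) by apply: cosh_scale_le; rewrite l1 ltW.
  have : y ^+ 2 / 2 * (cosh (l * y) - 1) <= (cosh y - 1) * (l * (cosh y - 1)).
    apply: ler_pM => //; first by rewrite divr_ge0// sqr_ge0.
    by rewrite subr_ge0 cosh_ge1.
  move: hi; rewrite exprMn => hi H.
  have l2' : 0 <= l ^+ 2 by rewrite sqr_ge0.
  have := ler_wpM2l l2' H; have := ler_wpM2l l3 c2; nra.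
have := expR_ge1Dx (l ^+ 2 / 2).
have l2' : 0 < l ^+ 2 / 2 by rewrite divr_gt0// exprn_gt0.
move=> H1 H2; rewrite -subr_ge0 -(pmulr_rge0 _ l2').
have -> : l ^+ 2 / 2 * (a + 2 * l * expR 2 - 1) =
  l ^+ 2 / 2 * a + l ^+ 3 * expR 2 - l ^+ 2 / 2 by field.
lra.
Qed.

Lemma wsumD n c c' w : wsum Z n (fun i => c i + c' i) w = wsum Z n c w + wsum Z n c' w.
Proof. by rewrite /wsum -big_split/=; apply: eq_bigr => i _; rewrite mulrDl. Qed.

Lemma wsumB n c c' w : wsum Z n (fun i => c i - c' i) w = wsum Z n c w - wsum Z n c' w.
Proof. by rewrite /wsum -sumrB/=; apply: eq_bigr => i _; rewrite mulrBl. Qed.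

(** By the addition formula for cosh and orthogonality of the weights,
    E (cosh(l Y) - 1) (cosh(l Y') - 1) = (exp(l^2/2) - 1)^2, and the left side is
    at least l^4/4 E Y^2 Y'^2.  Now let l tend to 0. *)
Lemma nonneg_mean_sqrM_le1 n c c' :
  \sum_(1 <= i < n.+1) c i ^+ 2 = 1 -> \sum_(1 <= i < n.+1) c' i ^+ 2 = 1 ->
  \sum_(1 <= i < n.+1) c i * c' i = 0 ->
  exists2 a, nonneg_mean P (fun w => wsum Z n c w ^+ 2 * wsum Z n c' w ^+ 2) a & a <= 1.
Proof.
move=> c1 c'1 cc'.
have mc l : nonneg_mean P (fun w => cosh (l * wsum Z n c w)) (expR (l ^+ 2 / 2)).
  by have := nonneg_mean_cosh n c l; rewrite c1 mulr1.
have mc' l : nonneg_mean P (fun w => cosh (l * wsum Z n c' w)) (expR (l ^+ 2 / 2)).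
  by have := nonneg_mean_cosh n c' l; rewrite c'1 mulr1.
have mp l : nonneg_mean P (fun w => cosh (l * wsum Z n c w) * cosh (l * wsum Z n c' w))
    (expR (l ^+ 2)).
  rewrite (_ : (fun w => _) = (fun w => 2^-1 * (cosh (l * wsum Z n (fun i => c i + c' i) w)
    + cosh (l * wsum Z n (fun i => c i - c' i) w)))); last first.
    by apply/funext => w; rewrite wsumD wsumB coshM (mulrDr l) (mulrBr l) [RHS]mulrC.
  have -> : expR (l ^+ 2) = 2^-1 * (expR (l ^+ 2) + expR (l ^+ 2)) by field.
  apply: nonneg_meanZ; first by rewrite invr_ge0.
  have /= := nonneg_mean_cosh n (fun i => c i + c' i) l.
  have /= := nonneg_mean_cosh n (fun i => c i - c' i) l.
  have -> : \sum_(1 <= i < n.+1) (c i + c' i) ^+ 2 = 2.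
    rewrite (eq_bigr (fun i => c i ^+ 2 + c' i ^+ 2 + 2 * (c i * c' i))); last by move=> i _; ring.
    by rewrite !big_split/= -mulr_sumr c1 c'1 cc'; ring.
  have -> : \sum_(1 <= i < n.+1) (c i - c' i) ^+ 2 = 2.
    rewrite (eq_bigr (fun i => c i ^+ 2 + c' i ^+ 2 - 2 * (c i * c' i))); last by move=> i _; ring.
    by rewrite sumrB !big_split/= -mulr_sumr c1 c'1 cc'; ring.
  have -> : l ^+ 2 * 2 / 2 = l ^+ 2 by field.
  by move=> H1 H2; exact: nonneg_meanD.
have mYY' : measurable_fun setT (fun w => wsum Z n c w ^+ 2 * wsum Z n c' w ^+ 2).
  by apply: measurable_funM; apply: measurable_funX; exact: measurable_wsum.
have [//||a Ya _] := @nonneg_mean_dominated _ _ _ P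
    (fun w => wsum Z n c w ^+ 2 * wsum Z n c' w ^+ 2)
    (fun w => 4 * (cosh (1 * wsum Z n c w) * cosh (1 * wsum Z n c' w))) (4 * expR (1 ^+ 2)) _ _
    (nonneg_meanZ (ler0n _ 4) (mp 1)).
  move=> w; rewrite !mul1r mulr_ge0 ?sqr_ge0//=.
  have /andP[lo _] := cosh_bounds (wsum Z n c w).
  have /andP[lo' _] := cosh_bounds (wsum Z n c' w).
  have -> : 4 * (cosh (wsum Z n c w) * cosh (wsum Z n c' w)) =
    (2 * cosh (wsum Z n c w)) * (2 * cosh (wsum Z n c' w)) by ring.
  by apply: ler_pM; rewrite ?sqr_ge0//; lra.
exists a => //.
(* here l^2 = 2 x, and exp x - 1 <= x exp x *)
have bound x : 0 < x -> a <= expR (2 * x).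
  move=> x0; pose l := Num.sqrt (2 * x).
  have l2 : l ^+ 2 = 2 * x by rewrite sqr_sqrtr// mulr_ge0// ltW.
  have l4 : 0 <= l ^+ 4 / 4 by rewrite divr_ge0// exprn_ge0// sqrtr_ge0.
  have := nonneg_mean_le _
    (nonneg_meanD (nonneg_meanZ l4 Ya) (nonneg_meanD (mc l) (mc' l)))
    (nonneg_meanD (mp l) (nonneg_mean_cst P ler01)).
  have -> : l ^+ 4 = (l ^+ 2) ^+ 2 by ring.
  rewrite l2 => H.
  have {H} : (2 * x) ^+ 2 / 4 * a + (expR (2 * x / 2) + expR (2 * x / 2)) <= expR (2 * x) + 1.
    apply: H => w; set y := wsum _ _ _ _; set y' := wsum _ _ _ _.
    have /andP[lo _] := cosh_bounds (l * y); have /andP[lo' _] := cosh_bounds (l * y').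
    have : (l * y) ^+ 2 / 2 * ((l * y') ^+ 2 / 2) <= (cosh (l * y) - 1) * (cosh (l * y') - 1).
      by apply: ler_pM => //; rewrite divr_ge0// sqr_ge0.
    rewrite !exprMn l2.
    have -> : 2 * x * y ^+ 2 / 2 * (2 * x * y' ^+ 2 / 2) =
      2 ^+ 2 * x ^+ 2 / 4 * (y ^+ 2 * y' ^+ 2) by field.
    lra.
  have -> : 2 * x / 2 = x by field.
  have E0 := expR_gt0 x.
  have e2 : expR (2 * x) = expR x ^+ 2 by rewrite expRM_natl.
  have : expR x * (1 - x) <= 1.
    have := expR_ge1Dx (- x); rewrite expRN.
    by rewrite -[X in _ -> _ <= X](@mulfV _ (expR x)) ?gt_eqF// ler_pM2l.
  rewrite e2 => H1 H2.
  have {H2} H3 : x ^+ 2 * a <= (expR x - 1) ^+ 2 by nra.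
  have x20 : 0 < x ^+ 2 by rewrite exprn_gt0.
  rewrite -(ler_pM2l x20) (le_trans H3)//.
  rewrite -exprMn ler_sqr ?nnegrE; [lra| |by rewrite mulr_ge0// ltW].
  by rewrite subr_ge0 -expR0 ler_expR ltW.
rewrite leNgt; apply/negP => a1.
have a0 : 0 < a by rewrite (lt_trans ltr01).
have lna : 0 < ln a by rewrite ln_gt0.
have := bound (ln a / 4); rewrite divr_gt0// => /(_ isT).
rewrite -{1}(lnK a0) ler_expR; lra.
Qed.

(** Chernoff's bound, on both sides at once: cosh(t Y) >= exp(t^2) / 2 as soon as
    |Y| >= t. *)
Lemma wsum_tail n c t : \sum_(1 <= i < n.+1) c i ^+ 2 = 1 -> 0 < t ->
  (P [set w | (t <= `|wsum Z n c w|)%R] <= (2 * expR (- (t ^+ 2 / 2)))%:E)%E.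
Proof.
move=> c1 t0; have := nonneg_mean_cosh n c t; rewrite c1 mulr1 => mc.
have E0 : 0 < expR (t ^+ 2) / 2 by rewrite divr_gt0// expR_gt0.
have := nonneg_mean_markov E0 mc.
rewrite invf_div mulrCA -expRB.
have -> : t ^+ 2 / 2 - t ^+ 2 = - (t ^+ 2 / 2) by field.
apply: le_trans; apply: le_measure; rewrite ?inE.
- by apply: measurable_le; apply: measurableT_comp => //; exact: measurable_wsum.
- by apply: measurable_le; case: mc.
- move=> w /=; set y := wsum _ _ _ _ => ty.
  have -> : cosh (t * y) = cosh (t * `|y|).
    by case: (leP 0 y) => [/ger0_norm->|/ltr0_norm->]; rewrite ?mulrN ?coshN.
  rewrite /cosh ler_pM2r ?invr_gt0//.
  rewrite (le_trans (_ : _ <= expR (t * `|y|)))//; last by rewrite lerDl expR_ge0.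
  by rewrite ler_expR expr2 ler_pM2l.
Qed.

End gaussian_moments.

Section concentration.
Context d (T : measurableType d) (R : realType) (P : probability T R).
Variable Z : nat -> T -> R.
Hypothesis gaussZ : gaussian_sequence P Z.

(** With S the sum of the squares and l their number,
    (S - l)^2 + 2 l S = S^2 + l^2, where only non-negative terms occur.  Here
    E S >= l, and E S^2 is at most l^2 up to a multiple of l coming from the
    diagonal terms. *)
Lemma wsum_sqr_variance (J : finType) n (a : J -> nat -> R) :
  (forall j, \sum_(1 <= i < n.+1) a j i ^+ 2 = 1) ->
  (forall j j', j != j' -> \sum_(1 <= i < n.+1) a j i * a j' i = 0) ->
  exists2 q, nonneg_mean P
      (fun w => (\sum_j wsum Z n (a j) w ^+ 2 - #|J|%:R) ^+ 2) q
    & q <= 4 * expR 2 * #|J|%:R.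
Proof.
move=> a1 aa.
have /choice[m mP] : forall j, exists m,
    nonneg_mean P (fun w => wsum Z n (a j) w ^+ 2) m /\ 1 <= m.
  move=> j; have [x] := nonneg_mean_sqr_ge1 gaussZ (a1 j).
  by exists x.
have /choice[b bP] : forall jj : J * J, exists b,
    nonneg_mean P (fun w => wsum Z n (a jj.1) w ^+ 2 * wsum Z n (a jj.2) w ^+ 2) b
    /\ b <= 1 + (if jj.1 == jj.2 then 4 * expR 2 else 0).
  move=> -[j j'] /=; case: eqP => [<-|/eqP jj'].
    have [x] := nonneg_mean_exp4 gaussZ (a1 j).
    exists x; split.
      by under eq_fun do rewrite -exprD.
    by rewrite (le_trans q)// lerDr.
  have [x] := nonneg_mean_sqrM_le1 gaussZ (a1 j) (a1 j') (aa _ _ jj').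
  by exists x; rewrite addr0.
pose l : R := #|J|%:R.
have lE : \sum_(j : J) (1 : R) = l by rewrite sumr_const.
have l0 : 0 <= l by exact: ler0n.
pose S w := \sum_j wsum Z n (a j) w ^+ 2.
have S_ge0 w : 0 <= S w by apply: sumr_ge0 => j _; exact: sqr_ge0.
have meanS : nonneg_mean P S (\sum_j m j).
  by apply: nonneg_mean_sum => j _; case: (mP j).
have meanS2 : nonneg_mean P (fun w => S w ^+ 2) (\sum_j \sum_j' b (j, j')).
  rewrite (_ : (fun w => _) = (fun w =>
      \sum_j \sum_j' wsum Z n (a j) w ^+ 2 * wsum Z n (a j') w ^+ 2)).
    apply: nonneg_mean_sum => j _; apply: nonneg_mean_sum => j' _.
    by case: (bP (j, j')).
  apply/funext => w; rewrite expr2 {1}/S mulr_suml; apply: eq_bigr => j _.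
  by rewrite mulr_sumr.
have lem : l <= \sum_j m j.
  by rewrite -lE; apply: ler_sum => j _; case: (mP j).
have leb : \sum_j \sum_j' b (j, j') <= l ^+ 2 + 4 * expR 2 * l.
  rewrite (le_trans (_ : _ <= \sum_(j : J) (l + 4 * expR 2)))//.
    apply: ler_sum => j _.
    rewrite (le_trans (_ : _ <= \sum_j' (1 + (if j == j' then 4 * expR 2 else 0))))//.
      by apply: ler_sum => j' _; case: (bP (j, j')).
    rewrite big_split/= lE lerD2l (bigD1 j)//= eqxx big1 ?addr0// => j' jj'.
    by rewrite eq_sym (negbTE jj').
  by rewrite sumr_const -mulr_natr -/l; lra.
have meanl : nonneg_mean P (fun=> l ^+ 2) (l ^+ 2).
  by apply: nonneg_mean_cst; exact: sqr_ge0.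
have mS : measurable_fun setT S by case: meanS.
have [||q Qq _] := @nonneg_mean_dominated _ _ _ P
    (fun w => (S w - l) ^+ 2) (fun w => S w ^+ 2 + l ^+ 2) _ _ _
    (nonneg_meanD meanS2 meanl).
- by apply: measurable_funX; apply: measurable_funB.
- move=> w; rewrite sqr_ge0/= sqrrB -subr_ge0.
  have := mulr_ge0 (S_ge0 w) l0; lra.
exists q => //.
have l20 : 0 <= 2 * l by rewrite mulr_ge0.
have := nonneg_mean_le _ (nonneg_meanD Qq (nonneg_meanZ l20 meanS))
  (nonneg_meanD meanS2 meanl).
move=> H; have {}H : q + 2 * l * \sum_j m j <= \sum_j \sum_j' b (j, j') + l ^+ 2.
  by apply: H => w; rewrite le_eqVlt; apply/orP; left; apply/eqP; ring.
have := ler_wpM2l l20 lem; rewrite -/l; lra.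
Qed.

Lemma wsum_sqr_concentration (J : finType) n (a : J -> nat -> R) (t : R) :
  0 < t -> (0 < #|J|)%N ->
  (forall j, \sum_(1 <= i < n.+1) a j i ^+ 2 = 1) ->
  (forall j j', j != j' -> \sum_(1 <= i < n.+1) a j i * a j' i = 0) ->
  (P [set w | (t * Num.sqrt #|J|%:R <=
       `|\sum_j wsum Z n (a j) w ^+ 2 - #|J|%:R|)%R] <=
   (4 * expR 2 / t ^+ 2)%:E)%E.
Proof.
move=> t0 J0 a1 aa.
have l0 : 0 < #|J|%:R :> R by rewrite ltr0n.
have [q Qq ql] := wsum_sqr_variance a1 aa.
have e0 : 0 < t ^+ 2 * #|J|%:R by rewrite mulr_gt0// exprn_gt0.
have := nonneg_mean_markov e0 Qq.
rewrite (_ : [set w | _] = [set w | (t * Num.sqrt #|J|%:R <=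
       `|\sum_j wsum Z n (a j) w ^+ 2 - #|J|%:R|)%R]).
  move=> /le_trans; apply; rewrite lee_fin ler_pdivrMr// mulrA divfK ?gt_eqF//.
  by rewrite exprn_gt0.
have tl0 : 0 <= t * Num.sqrt #|J|%:R by rewrite mulr_ge0// ?sqrtr_ge0// ltW.
have -> : t ^+ 2 * #|J|%:R = (t * Num.sqrt #|J|%:R) ^+ 2 by rewrite exprMn sqr_sqrtr// ltW.
apply/seteqP; split => w /=; set x := _ - _;
  by rewrite -(real_normK (num_real x)) ler_sqr ?nnegrE.
Qed.

End concentration.

(** * Uniform approximation on an event of large probability *)

Lemma measurable_bigmax d (T : measurableType d) (R : realType) (I : Type)
    (s : seq I) (f : I -> T -> R) : (forall i, measurable_fun setT (f i)) ->
  measurable_fun setT (fun w => \big[Num.max/0]_(i <- s) f i w).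
Proof.
move=> mf; elim: s => [|i s IH].
  by under eq_fun do rewrite big_nil; exact: measurable_cst.
by under eq_fun do rewrite big_cons; exact: (measurable_maxr (mf i) IH).
Qed.

Section sip_event.
Context d (T : measurableType d) (R : realType) (P : probability T R).

(** By Egorov's theorem almost sure convergence is uniform off a small event,
    which is then enlarged by the null event where B_0 is not 0; elsewhere
    B_i is the sum of its first i increments. *)
Lemma sip_uniform_event (y : nat -> T -> R) (B : R -> T -> R) (v : R)
    (Delta : nat -> R) (N0 : nat) (eps : R) :
  (forall i, (0 < i)%N -> measurable_fun [set: T] (y i)) ->
  standard_brownian_motion P B ->
  {ae P, forall w,
    (fun n : nat => (\big[Num.max/0]_(1 <= i < n.+1)
        `|\sum_(1 <= j < i.+1) y j w - v * B i%:R w|) / Delta n)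
    @ \oo --> (0 : R)} ->
  (forall n, (N0 <= n)%N -> 0 < Delta n) ->
  0 < eps ->
  exists E, [/\ measurable E, (P E <= eps%:E)%E &
    \forall n \near \oo, forall w, ~ E w -> forall i, (i <= n)%N ->
      `|\sum_(1 <= j < i.+1) (y j w - v * (B j%:R w - B j.-1%:R w))| <= Delta n].
Proof.
move=> my [mB B0 _ _ _] sip Delta0 eps0.
have mBi i : measurable_fun setT (B i%:R) by exact: mB.
pose f (n : nat) w := (\big[Num.max/0]_(1 <= i < n.+1)
        `|\sum_(1 <= j < i.+1) y j w - v * B i%:R w|) / Delta n.
have mf n : measurable_fun setT (f n).
  apply: measurable_funM => //; apply: measurable_bigmax => i.
  apply: measurableT_comp => //; apply: measurable_funB.
    rewrite (_ : (fun w => _) = (fun w => \sum_(1 <= j < i.+1) (if (0 < j)%N then y j w else 0))).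
      apply: measurable_sum => j; case: (posnP j) => [_|j0].
        exact: measurable_cst.
      exact: my.
    by apply/funext => w; apply: eq_big_nat => j /andP[-> _].
  exact: measurable_funM.
have [||E [mE PE cvgE]] := @ae_pointwise_almost_uniform _ _ _ P f (cst 0) setT eps
    mf (measurable_cst _) measurableT _ _ eps0.
- by apply: le_lt_trans (probability_le1 P measurableT) _; rewrite ltry.
- by apply: filterS sip => w H _.
have [N [mN PN BN]] := B0.
exists (E `|` N); split.
- exact: measurableU.
- by rewrite measureU0// ltW.
have Ecvg : \forall n \near \oo, forall w, (setT `\` E) w -> `|0 - f n w| < 1.
  have ent : entourage [set xy : R * R | ball xy.1 1 xy.2].
    exact: (entourage_ball _ (PosNum ltr01)).
  apply: (cvgE [set h | forall w, (setT `\` E) w -> ball (0 : R) 1 (h w)]).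
  apply/uniform_nbhs.
  by exists [set xy : R * R | ball xy.1 1 xy.2]; split.
near=> n => w EN i ni.
have nN0 : (N0 <= n)%N by near: n; exact: nbhs_infty_ge.
have {}Delta0 := Delta0 _ nN0.
have B0w : B 0 w = 0.
  by apply: contrapT => B0w; apply: EN; right; apply: BN.
have fle : f n w < 1.
  have Ew : (setT `\` E) w by split => // Ew; apply: EN; left.
  suff H : forall w, (setT `\` E) w -> `|0 - f n w| < 1.
    by have := H _ Ew; rewrite sub0r normrN; exact: le_lt_trans (ler_norm _).
  by near: n.
rewrite sumrB -mulr_sumr.
have -> : \sum_(1 <= j < i.+1) (B j%:R w - B j.-1%:R w) = B i%:R w.
  rewrite big_add1 /= telescope_sumr// B0w subr0//.
case: (posnP i) => [->|i0].
  by rewrite big_nil B0w mulr0 subrr normr0 ltW.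
rewrite (le_trans (_ : _ <= \big[Num.max/0]_(1 <= i < n.+1)
        `|\sum_(1 <= j < i.+1) y j w - v * B i%:R w|))//.
  apply: (le_bigmax_seq 0 i xpredT (fun i => `|\sum_(1 <= j < i.+1) y j w - v * B i%:R w|)) => //.
  by rewrite mem_index_iota i0 ltnS.
by move: fle; rewrite /f ltr_pdivrMr// mul1r => /ltW.
Unshelve. all: by end_near. Qed.

End sip_event.

(** * Summation by parts over blocks *)

Section abel.
Context {R : realType}.
Implicit Types (s x : nat -> R) (a b n k j : nat) (D : R).

Lemma summation_by_parts s x a b :
  let W i := \sum_(1 <= j < i.+1) x j in
  (a < b)%N ->
  \sum_(a.+1 <= i < b.+1) s i * x i =
  s b * W b - s a.+1 * W a - \sum_(a.+2 <= i < b.+1) (s i - s i.-1) * W i.-1.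
Proof.
move=> W; have WS i : W i.+1 = W i + x i.+1 by rewrite /W big_nat_recr.
elim: b => // b IH; rewrite ltnS leq_eqVlt => /predU1P[<-|ab].
  by rewrite big_nat1 big_geq// WS; ring.
rewrite big_nat_recr ?ltnS//=; last exact: ltnW.
by rewrite IH// [in RHS]big_nat_recr ?ltnS//= WS; ring.
Qed.

(** Summation by parts leaves the two boundary terms and the variation of s; the
    weight at the left end is itself bounded by the weight at the right end
    plus the variation. *)
Lemma abel_bound s x a b D : (a < b)%N ->
  (forall i, (i <= b)%N -> `|\sum_(1 <= j < i.+1) x j| <= D) ->
  `|\sum_(a.+1 <= i < b.+1) s i * x i| <=
  2 * D * (`|s b| + \sum_(a.+2 <= i < b.+1) `|s i - s i.-1|).
Proof.
move=> ab WD; have D0 : 0 <= D := le_trans (normr_ge0 _) (WD 0%N (leq0n _)).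
have sa : `|s a.+1| <= `|s b| + \sum_(a.+2 <= i < b.+1) `|s i - s i.-1|.
  have -> : s a.+1 = s b - \sum_(a.+2 <= i < b.+1) (s i - s i.-1).
    by rewrite big_add1 /= telescope_sumr//; ring.
  by rewrite (le_trans (ler_normB _ _))// lerD2l ler_norm_sum.
rewrite summation_by_parts//.
rewrite (le_trans (ler_normB _ _))// (le_trans (lerD (ler_normB _ _) (lexx _)))//.
rewrite !normrM.
have H1 := ler_wpM2l (normr_ge0 (s b)) (WD b (leqnn b)).
have H2 := ler_wpM2l (normr_ge0 (s a.+1)) (WD a (ltnW ab)).
have H3 : `|\sum_(a.+2 <= i < b.+1) (s i - s i.-1) * \sum_(1 <= j < i.-1.+1) x j| <=
    \sum_(a.+2 <= i < b.+1) `|s i - s i.-1| * D.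
  rewrite (le_trans (ler_norm_sum _ _ _))//; apply: ler_sum_nat => i /andP[_ ib].
  rewrite normrM ler_wpM2l// WD//.
  by rewrite (leq_trans (leq_pred _)).
rewrite -mulr_suml in H3.
have := ler_wpM2r D0 sa; lra.
Qed.

Lemma block_sum_ge0 k j (F : nat -> R) : (forall i, 0 <= F i) -> 0 <= block_sum k j F.
Proof. by move=> F0; apply: sumr_ge0. Qed.

Lemma block_lt k j : (0 < k)%N -> (0 < j)%N -> (j.-1 * k < j * k)%N.
Proof. by move=> k0; case: j => //= j _; rewrite ltn_pmul2r. Qed.

Lemma block_le n k j : (j <= nblocks n k)%N -> (j * k <= n)%N.
Proof. by move=> jl; apply: leq_trans (leq_trunc_div n k); rewrite leq_mul2r jl orbT. Qed.

Lemma block_abel_bound s x k j D : (0 < k)%N -> (0 < j)%N ->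
  (forall i, (i <= j * k)%N -> `|\sum_(1 <= j < i.+1) x j| <= D) ->
  `|block_sum k j (fun i => s i * x i)| <= 2 * D * block_r k s j.
Proof.
move=> k0 j0 WD; have D0 : 0 <= D := le_trans (normr_ge0 _) (WD 0%N (leq0n _)).
rewrite (le_trans (abel_bound s (block_lt k0 j0) WD))//.
rewrite ler_wpM2l ?mulr_ge0// /block_r lerD2l /block_sum.
rewrite [leRHS]big_ltn ?ltnS ?block_lt//.
rewrite ler_wpDl//; apply: ler_sum_nat => i /andP[ai _].
by case: i ai => [|[|i]].
Qed.

Lemma total_abel_bound s x n D : (0 < n)%N ->
  (forall i, (i <= n)%N -> `|\sum_(1 <= j < i.+1) x j| <= D) ->
  `|\sum_(1 <= i < n.+1) s i * x i| <= 2 * D * total_r n s.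
Proof. by move=> n0 WD; exact: abel_bound. Qed.

Lemma sum_block_indicator (F : nat -> R) a b n : (a <= b)%N -> (b <= n)%N ->
  \sum_(1 <= i < n.+1) (if (a < i <= b)%N then F i else 0) =
  \sum_(a.+1 <= i < b.+1) F i.
Proof.
move=> ab bn; rewrite -big_mkcond/=.
rewrite [RHS](big_nat_widen _ _ n.+1)// [RHS](big_nat_widenl _ 1)//=.
by apply: eq_bigl => i; rewrite ltnS andbC.
Qed.

End abel.

(** * Gaussian block sums *)

Section positivity.
Context {R : realType}.
Implicit Types (s : nat -> R) (n k j : nat).

Lemma nblocks_gt0 n k : (0 < k <= n)%N -> (0 < nblocks n k)%N.
Proof. by move=> /andP[k0 kn]; rewrite /nblocks divn_gt0. Qed.

Lemma block_Sigma_gt0 s n k j : (forall i, (0 < i <= n)%N -> 0 < s i) ->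
  (0 < k)%N -> (0 < j <= nblocks n k)%N -> 0 < block_Sigma k s j.
Proof.
move=> s0 k0 /andP[j0 jl]; rewrite sqrtr_gt0 /block_sum big_ltn ?ltnS ?block_lt//.
rewrite ltr_pwDl//; last by apply: sumr_ge0 => i _; exact: sqr_ge0.
rewrite exprn_gt0// s0//=.
exact: leq_trans (block_lt k0 j0) (block_le jl).
Qed.

Lemma total_Sigma_gt0 s n : (forall i, (0 < i <= n)%N -> 0 < s i) ->
  (0 < n)%N -> 0 < total_Sigma n s.
Proof.
move=> s0 n0; rewrite sqrtr_gt0 big_ltn//.
rewrite ltr_pwDl//; last by apply: sumr_ge0 => i _; exact: sqr_ge0.
by rewrite exprn_gt0// s0.
Qed.

Lemma block_Sigma_sqr s k j : block_Sigma k s j ^+ 2 = block_sum k j (fun i => s i ^+ 2).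
Proof. by rewrite sqr_sqrtr// block_sum_ge0// => i; exact: sqr_ge0. Qed.

Lemma total_Sigma_sqr s n : total_Sigma n s ^+ 2 = \sum_(1 <= i < n.+1) s i ^+ 2.
Proof. by rewrite sqr_sqrtr//; apply: sumr_ge0 => i _; exact: sqr_ge0. Qed.

End positivity.

Section block_weights.
Context {R : realType}.
Implicit Types (s : nat -> R) (n k j : nat).

(** Coefficients of the normalised sum over block j as a linear form in all of the
    variables 1, ..., n.  Different blocks have disjoint supports, hence
    orthogonal coefficients. *)
Definition block_weight k s j (i : nat) : R :=
  if (j.-1 * k < i <= j * k)%N then s i / block_Sigma k s j else 0.

Lemma block_weight_sqr s n k j : (forall i, (0 < i <= n)%N -> 0 < s i) ->
  (0 < k)%N -> (0 < j <= nblocks n k)%N ->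
  \sum_(1 <= i < n.+1) block_weight k s j i ^+ 2 = 1.
Proof.
move=> s0 k0 jl; have S0 := block_Sigma_gt0 s0 k0 jl.
have /andP[j0 jle] := jl.
rewrite (eq_bigr (fun i => if (j.-1 * k < i <= j * k)%N
    then (s i / block_Sigma k s j) ^+ 2 else 0)); last first.
  by move=> i _; rewrite /block_weight; case: ifP; rewrite ?expr0n.
rewrite sum_block_indicator ?(block_le jle)//; last by apply: ltnW; exact: block_lt.
under eq_bigr do rewrite exprMn.
by rewrite -mulr_suml -/(block_sum k j _) -block_Sigma_sqr exprVn mulfV// expf_neq0// gt_eqF.
Qed.

Lemma block_weight_disjoint s k j j' i : (0 < j)%N -> (0 < j')%N ->
  j != j' -> block_weight k s j i * block_weight k s j' i = 0.
Proof.
wlog jj' : j j' / (j < j')%N.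
  move=> H j0 j'0; rewrite neq_ltn => /orP[|] jj'; last rewrite mulrC; apply: H => //.
    by rewrite neq_ltn jj'.
  by rewrite neq_ltn jj'.
move=> j0 j'0 _; rewrite /block_weight; case: ifP => [/andP[_ ij]|]; last by rewrite mul0r.
case: ifP => [/andP[ij' _]|]; last by rewrite mulr0.
suff : (j * k <= j'.-1 * k)%N by move=> /(leq_trans ij); rewrite leqNgt ij'.
by rewrite leq_mul2r -ltnS prednK// jj' orbT.
Qed.

Lemma wsum_block_weight T (Z : nat -> T -> R) s n k j w :
  (0 < k)%N -> (0 < j <= nblocks n k)%N ->
  wsum Z n (block_weight k s j) w =
  block_sum k j (fun i => s i * Z i w) / block_Sigma k s j.
Proof.
move=> k0 /andP[j0 jle]; rewrite /wsum.
rewrite (eq_bigr (fun i => if (j.-1 * k < i <= j * k)%N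
    then s i * Z i w / block_Sigma k s j else 0)); last first.
  by move=> i _; rewrite /block_weight; case: ifP; rewrite ?mul0r// mulrAC.
rewrite sum_block_indicator ?(block_le jle)//; last by apply: ltnW; exact: block_lt.
by rewrite -mulr_suml.
Qed.

End block_weights.

Section gauss_blocks.
Context d (T : measurableType d) (R : realType) (P : probability T R).
Variable Z : nat -> T -> R.
Hypothesis gaussZ : gaussian_sequence P Z.
Implicit Types (s : nat -> R) (n k j : nat).

(** Chebyshev's inequality for the sum of the squares, and the exponential tail
    bound for the rest.  At the level 2 sqrt(log n) the tail is 2 / n^2, which
    survives the union over at most n blocks. *)
Lemma gaussian_blocks_event (eps : R) : 0 < eps ->
  exists2 t : R, 0 < t & \forall n \near \oo, forall k s, (0 < k <= n)%N ->
    (forall i, (0 < i <= n)%N -> 0 < s i) ->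
    let g j w := block_sum k j (fun i => s i * Z i w) / block_Sigma k s j in
    let l := nblocks n k in
    exists E, [/\ measurable E, (P E <= eps%:E)%E &
      forall w, ~ E w ->
      [/\ `|\sum_(1 <= j < l.+1) g j w ^+ 2 - l%:R| <= t * Num.sqrt l%:R,
          `|(\sum_(1 <= i < n.+1) s i * Z i w) / total_Sigma n s| <= t &
          forall j, (0 < j <= l)%N -> g j w ^+ 2 <= 4 * ln n%:R]].
Proof.
(* this t makes each of the two exceptional events in which it occurs have
   probability at most eps / 3 *)
move=> eps0; pose t := Num.sqrt (12 * expR 2 / eps).
have E20 : 0 < expR 2 :> R by exact: expR_gt0.
have t0 : 0 < t by rewrite sqrtr_gt0 divr_gt0// mulr_gt0.
have t2 : t ^+ 2 = 12 * expR 2 / eps by rewrite sqr_sqrtr// ltW// divr_gt0// mulr_gt0.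
exists t => //; near=> n.
have n6 : 6 / eps <= n%:R by near: n; exact: nbhs_infty_ger.
have n2 : (2 <= n)%N by near: n; exact: nbhs_infty_ge.
move=> k s kn s0; rewrite /=.
set l := nblocks n k.
pose g j w := block_sum k j (fun i => s i * Z i w) / block_Sigma k s j.
have n0 : 0 < n%:R :> R by rewrite ltr0n (leq_trans _ n2).
have l0 : (0 < l)%N by exact: nblocks_gt0.
have k0 : (0 < k)%N by case/andP: kn.
have lln : 0 < ln n%:R :> R by rewrite ln_gt0// ltr1n.
have jl (j : 'I_l) : (0 < j.+1 <= l)%N by rewrite ltn_ord.
pose c (j : 'I_l) := block_weight k s j.+1.
have c1 (j : 'I_l) : \sum_(1 <= i < n.+1) c j i ^+ 2 = 1 by exact: block_weight_sqr.
have cc (j j' : 'I_l) : j != j' -> \sum_(1 <= i < n.+1) c j i * c j' i = 0.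
  by move=> jj'; apply: big1 => i _; apply: block_weight_disjoint.
pose ct i := s i / total_Sigma n s.
have S0 : 0 < total_Sigma n s by apply: total_Sigma_gt0; rewrite // (leq_trans _ n2).
have ct1 : \sum_(1 <= i < n.+1) ct i ^+ 2 = 1.
  under eq_bigr do rewrite exprMn.
  by rewrite -mulr_suml -total_Sigma_sqr exprVn mulfV// expf_neq0// gt_eqF.
pose E1 := [set w | t * Num.sqrt #|'I_l|%:R <= `|\sum_j wsum Z n (c j) w ^+ 2 - #|'I_l|%:R|].
pose E2 := [set w | t <= `|wsum Z n ct w|].
pose u : R := 2 * Num.sqrt (ln n%:R).
have u0 : 0 < u by rewrite mulr_gt0// sqrtr_gt0.
pose A j := [set w | u <= `|wsum Z n (block_weight k s j.+1) w|].
pose E3 := \big[setU/set0]_(j < l) A j.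
have mwsum b : measurable_fun setT (fun w => wsum Z n b w) by exact: (measurable_wsum gaussZ).
have mE1 : measurable E1.
  apply: measurable_le; apply: measurableT_comp => //; apply: measurable_funB => //.
  by apply: measurable_sum => j; apply: measurable_funX; exact: mwsum.
have mE2 : measurable E2 by apply: measurable_le; apply: measurableT_comp => //; exact: mwsum.
have mA j : measurable (A j) by apply: measurable_le; apply: measurableT_comp => //; exact: mwsum.
have mE3 : measurable E3 by exact: bigsetU_measurable.
exists (E1 `|` E2 `|` E3); split.
- by apply: measurableU => //; exact: measurableU.
- have P1 : (P E1 <= (eps / 3)%:E)%E.
    apply: le_trans (wsum_sqr_concentration gaussZ t0 _ c1 cc) _; first by rewrite card_ord.
    by rewrite lee_fin t2 le_eqVlt; apply/orP; left; apply/eqP; field; rewrite !gt_eqF.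
  have P2 : (P E2 <= (eps / 3)%:E)%E.
    apply: le_trans (wsum_tail gaussZ ct1 t0) _; rewrite lee_fin expRN.
    have e1 : t ^+ 2 / 2 <= expR (t ^+ 2 / 2) by have := expR_ge1Dx (t ^+ 2 / 2); lra.
    have t20 : 0 < t ^+ 2 / 2 by rewrite divr_gt0// exprn_gt0.
    rewrite (le_trans (_ : _ <= 2 * (t ^+ 2 / 2)^-1))//.
      by rewrite ler_pM2l// lef_pV2// posrE// expR_gt0.
    rewrite t2.
    have -> : 2 * (12 * expR 2 / eps / 2)^-1 = eps / 3 * (expR 2)^-1.
      by field; rewrite !gt_eqF.
    apply: ler_piMr; [by rewrite divr_ge0// ltW|rewrite invf_le1//].
    by have := expR_ge1Dx (2 : R); lra.
  have P3 : (P E3 <= (eps / 3)%:E)%E.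
    apply: le_trans (Boole_inequality _ _) _ => //.
    rewrite (le_trans (_ : _ <= \sum_(j < l) (2 * (n%:R ^- 2))%:E)%E)//.
      apply: lee_sum => j _; apply: le_trans (wsum_tail gaussZ (c1 j) u0) _.
      rewrite lee_fin ler_pM2l// /u exprMn sqr_sqrtr; last exact: ltW.
      have -> : 2 ^+ 2 * ln n%:R / 2 = 2 * ln n%:R :> R by field.
      by rewrite expRN expRM_natl lnK.
    rewrite sumEFin lee_fin sumr_const card_ord -[leLHS]mulr_natr.
    have ln' : l%:R <= n%:R :> R by rewrite ler_nat leq_div.
    rewrite (le_trans (_ : _ <= 2 * n%:R ^- 2 * n%:R))//.
      by rewrite ler_pM2l// mulr_gt0// invr_gt0 exprn_gt0.
    have -> : 2 * n%:R ^- 2 * n%:R = 2 / n%:R :> R by field; rewrite gt_eqF.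
    rewrite ler_pdivrMr//.
    by move: n6; rewrite ler_pdivrMr//; lra.
  have -> : eps%:E = (eps / 3 + eps / 3 + eps / 3)%:E by congr _%:E; field.
  rewrite !EFinD; apply: le_trans (measureU2 _ _ _) _ => //; first exact: measurableU.
  apply: leeD => //; apply: le_trans (measureU2 _ _ _) _ => //; exact: leeD.
- move=> w nE; split.
  + rewrite leNgt; apply/negP => H; apply: nE; left; left; rewrite /E1/= card_ord ltW//.
    rewrite (lt_le_trans H)// le_eqVlt; apply/orP; left; apply/eqP; congr (`|_ - _|).
    rewrite big_add1/= big_mkord; apply: eq_bigr => j _.
    by rewrite /c wsum_block_weight.
  + rewrite leNgt; apply/negP => H; apply: nE; left; right; rewrite /E2/= ltW//.
    rewrite (lt_le_trans H)// le_eqVlt; apply/orP; left; apply/eqP; congr (`|_|).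
    by rewrite /wsum mulr_suml; apply: eq_bigr => i _; rewrite /ct mulrAC.
  + move=> j jl'; have /andP[j0 jle] := jl'.
    have -> : 4 * ln n%:R = u ^+ 2 by rewrite exprMn sqr_sqrtr ?ltW//; ring.
    rewrite -/(g j w) -(real_normK (num_real (g j w))) ler_sqr ?nnegrE//; last exact: ltW.
    rewrite leNgt; apply/negP => H; apply: nE; right.
    rewrite /E3 -bigcup_mkord; exists j.-1 => /=; first by rewrite prednK.
    by rewrite /A/= prednK// wsum_block_weight// ltW.
Unshelve. all: by end_near. Qed.

End gauss_blocks.

(** * Deterministic consequences of the approximation *)

Section deterministic.
Context {R : realType}.
Implicit Types (s x z : nat -> R) (n k j : nat) (D v C : R).

Lemma max_blocks_ge0 n k (F : nat -> R) : 0 <= max_blocks n k F.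
Proof.
by rewrite /max_blocks; elim/big_rec: _ => // j y _ y0; rewrite le_max y0 orbT.
Qed.

Lemma le_max_blocks n k j (F : nat -> R) : (0 < j <= nblocks n k)%N ->
  F j <= max_blocks n k F.
Proof.
move=> jl; apply: (le_bigmax_seq 0 j xpredT F) => //.
by rewrite mem_index_iota ltnS.
Qed.

Lemma block_r_ge0 k s j : 0 <= block_r k s j.
Proof. by rewrite addr_ge0// block_sum_ge0. Qed.

Lemma M_rate_bounds n k s D j : (0 < k)%N -> 0 <= D ->
  (0 < j <= nblocks n k)%N ->
  [/\ k%:R^-1 <= M_rate n k s D,
      block_Sigmastar2 k s j / block_Sigma k s j ^+ 2 <= M_rate n k s D,
      block_rstar k s j * D / block_Sigma k s j ^+ 2 <= M_rate n k s D &
      block_r k s j * D / block_Sigma k s j <= M_rate n k s D].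
Proof.
move=> k0 D0 jl.
pose F j := (block_Sigmastar2 k s j + block_rstar k s j * D) / block_Sigma k s j ^+ 2.
pose G j := block_r k s j * D / block_Sigma k s j.
have lF := le_max_blocks F jl; have lG := le_max_blocks G jl.
have F0 := max_blocks_ge0 n k F; have G0 := max_blocks_ge0 n k G.
have ki : 0 <= k%:R^-1 :> R by [].
have a0 : 0 <= block_Sigmastar2 k s j / block_Sigma k s j ^+ 2.
  by rewrite divr_ge0 ?sqrtr_ge0// sqr_ge0.
have b0 : 0 <= block_rstar k s j * D / block_Sigma k s j ^+ 2.
  by rewrite divr_ge0 ?sqr_ge0// mulr_ge0// (block_r_ge0 k (fun i => s i ^+ 2) j).
move: lF; rewrite {1}/F mulrDl /M_rate -/F -/G => lF.
rewrite -/(G j); split; lra.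
Qed.

Lemma M_rate_ge0 n k s D : 0 <= M_rate n k s D.
Proof.
by rewrite /M_rate !addr_ge0 ?max_blocks_ge0// invr_ge0.
Qed.

(** The numerator k (mean of block j - overall mean) for X_i = mu + s_i x_i. *)
Definition recentred_block n k s x j : R :=
  block_sum k j (fun i => s i * x i) -
  k%:R / n%:R * \sum_(1 <= i < n.+1) s i * x i.

(** What the first invariance principle contributes, phrased in terms of the
    noise x_1, ..., x_n alone so that its probability depends only on the law
    of the noise. *)
Definition good_sums n k s D v C x : Prop :=
  let l := nblocks n k in
  `|l%:R^-1 * \sum_(1 <= j < l.+1)
      (recentred_block n k s x j / block_Sigma k s j) ^+ 2 - v ^+ 2|
    <= C * chi_rate n k s D /\
  forall j, (0 < j <= l)%N ->
    (block_sum k j (fun i => s i * x i) / block_Sigma k s j) ^+ 2 <= C * ln n%:R.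

(** What the second invariance principle contributes, x being the centred squares
    of the noise. *)
Definition good_squares n k s D C x : Prop :=
  forall j, (0 < j <= nblocks n k)%N ->
    `|block_sum k j (fun i => s i ^+ 2 * x i)| / block_Sigma k s j ^+ 2
      <= C * (ln n%:R * M_rate n k s D).

Lemma chi_rate_bounds n k s D : (0 < n)%N ->
  let l := nblocks n k in
  [/\ 0 <= (Num.sqrt l%:R)^-1 :> R, 0 <= ln n%:R * M_rate n k s D,
      0 <= Num.sqrt (ln n%:R) * (total_Sigma n s / l%:R ^+ 2)
            * (\sum_(1 <= j < l.+1) (block_Sigma k s j)^-1) &
      0 <= total_Sigma n s ^+ 2 / l%:R ^+ 3
            * (\sum_(1 <= j < l.+1) (block_Sigma k s j ^+ 2)^-1)].
Proof.
move=> n0 l; split.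
- by rewrite invr_ge0 sqrtr_ge0.
- by rewrite mulr_ge0 ?M_rate_ge0// ln_ge0// ler1n.
- apply: mulr_ge0; last by apply: sumr_ge0 => j _; rewrite invr_ge0 sqrtr_ge0.
  by rewrite mulr_ge0 ?divr_ge0 ?sqrtr_ge0// sqr_ge0.
- apply: mulr_ge0; last by apply: sumr_ge0 => j _; rewrite invr_ge0 sqr_ge0.
  by rewrite divr_ge0 ?sqr_ge0// exprn_ge0.
Qed.

Lemma chi_rate_ge0 n k s D : (0 < n)%N -> 0 <= chi_rate n k s D.
Proof.
by move=> n0; have [a b c e] := chi_rate_bounds k s D n0; rewrite /chi_rate !addr_ge0.
Qed.

Section approximation.
Variables (n k : nat) (s x z : nat -> R) (D v : R).
Hypothesis kn : (0 < k <= n)%N.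
Hypothesis s_gt0 : forall i, (0 < i <= n)%N -> 0 < s i.
Hypothesis v_ge0 : 0 <= v.
Hypothesis lnn : 1 <= ln n%:R :> R.
Hypothesis approx : forall i, (i <= n)%N -> `|\sum_(1 <= j < i.+1) (x j - v * z j)| <= D.

Let l := nblocks n k.
Let M := M_rate n k s D.

Let k0 : (0 < k)%N. Proof. by case/andP: kn. Qed.
Let n0 : (0 < n)%N. Proof. by case/andP: kn => ? /(leq_trans k0). Qed.
Let D0 : 0 <= D. Proof. exact: le_trans (normr_ge0 _) (approx (leq0n _)). Qed.
Let l1 : (0 < l)%N. Proof. exact: nblocks_gt0. Qed.

Lemma block_sum_approx (r : nat -> R) j : (0 < j <= l)%N ->
  `|block_sum k j (fun i => r i * x i) - v * block_sum k j (fun i => r i * z i)| <=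
  2 * D * block_r k r j.
Proof.
move=> /andP[j0 jl].
rewrite /block_sum mulr_sumr -sumrB.
rewrite (eq_bigr (fun i => r i * (x i - v * z i))); last by move=> i _; ring.
apply: (@block_abel_bound _ r (fun i => x i - v * z i)) => // i ij.
exact: approx (leq_trans ij (block_le jl)).
Qed.

(** The weights are now s_i^2: block_r of these is block_rstar, and the standard
    deviation of their Gaussian block sum is block_Sigmastar2. *)
Lemma good_squares_of_approx :
  (forall j, (0 < j <= l)%N ->
     (block_sum k j (fun i => s i ^+ 2 * z i) / block_Sigma k (fun i => s i ^+ 2) j) ^+ 2
       <= 4 * ln n%:R) ->
  good_squares n k s D (2 * v + 2) x.
Proof.
move=> gauss j jl.
have S0 : 0 < block_Sigma k s j by exact: block_Sigma_gt0 s_gt0 k0 jl.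
have Sq0 : 0 < block_Sigma k (fun i => s i ^+ 2) j.
  by apply: block_Sigma_gt0 jl => // i /s_gt0 s0; rewrite exprn_gt0.
have S2 : 0 < block_Sigma k s j ^+ 2 by rewrite exprn_gt0.
have [_ Mstar Mr _] := M_rate_bounds s k0 D0 jl.
have starE : block_Sigmastar2 k s j = block_Sigma k (fun i => s i ^+ 2) j.
  by congr Num.sqrt; apply: eq_bigr => i _; rewrite -exprM.
set A := block_sum k j _.
set G := block_sum k j (fun i => s i ^+ 2 * z i).
have AG : `|A| <= v * `|G| + 2 * D * block_rstar k s j.
  have := block_sum_approx (fun i => s i ^+ 2) jl; rewrite -/A -/G => H.
  rewrite -[A](subrK (v * G)) addrC (le_trans (ler_normD _ _))// lerD//.
  by rewrite normrM ger0_norm.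
have Gle : `|G| <= 2 * ln n%:R * block_Sigmastar2 k s j.
  rewrite starE -ler_pdivrMr// -[X in _ / X]ger0_norm; last exact: ltW.
  rewrite -normf_div.
  rewrite -ler_sqr ?nnegrE ?mulr_ge0// ?(le_trans ler01)//.
  rewrite real_normK ?num_real// (le_trans (gauss _ jl))// exprMn.
  have := ler_wpM2l (le_trans ler01 lnn) lnn; lra.
rewrite ler_pdivrMr//.
move: Mstar Mr; rewrite !ler_pdivrMr// -/M => Mstar Mr.
have v2 : 0 <= v * (2 * ln n%:R) by rewrite !mulr_ge0// (le_trans ler01).
have := ler_wpM2l v_ge0 Gle; have := ler_wpM2l v2 Mstar.
have MS : 0 <= M * block_Sigma k s j ^+ 2 by rewrite mulr_ge0 ?M_rate_ge0// ltW.
have := ler_wpM2r MS lnn; lra.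
Qed.

Hypothesis M_le1 : M <= 1.
Variable t : R.
Hypothesis t_ge0 : 0 <= t.

Let g j := block_sum k j (fun i => s i * z i) / block_Sigma k s j.
Hypothesis gauss_lln : `|\sum_(1 <= j < l.+1) g j ^+ 2 - l%:R| <= t * Num.sqrt l%:R.
Hypothesis gauss_total : `|(\sum_(1 <= i < n.+1) s i * z i) / total_Sigma n s| <= t.
Hypothesis gauss_max : forall j, (0 < j <= l)%N -> g j ^+ 2 <= 4 * ln n%:R.
Hypothesis total_r_le1 : total_r n s * D / total_Sigma n s <= 1.

Let K := v * t + 2.
Let q := total_Sigma n s.
Let A := \sum_(1 <= i < n.+1) s i * x i.

Let q0 : 0 < q. Proof. exact: total_Sigma_gt0. Qed.
Let K0 : 0 <= K. Proof. by rewrite addr_ge0// mulr_ge0. Qed.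

Let A_le : `|A| <= K * q.
Proof.
have approxA : `|A - v * \sum_(1 <= i < n.+1) s i * z i| <= 2 * D * total_r n s.
  rewrite mulr_sumr -sumrB.
  rewrite (eq_bigr (fun i => s i * (x i - v * z i))); last by move=> i _; ring.
  exact: total_abel_bound.
rewrite -[A](subrK (v * \sum_(1 <= i < n.+1) s i * z i)) addrC.
rewrite (le_trans (ler_normD _ _))// /K mulrDl lerD//.
  rewrite normrM ger0_norm// -mulrA ler_wpM2l// -ler_pdivrMr//.
  rewrite -[X in _ / X]ger0_norm; last exact: ltW.
  by rewrite -normf_div.
rewrite (le_trans approxA)// -mulrA ler_pM2l// mulrC -[leRHS]mul1r -ler_pdivrMr//.
Qed.

Let eps j := block_sum k j (fun i => s i * x i) / block_Sigma k s j - v * g j.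

Let eps_le j : (0 < j <= l)%N -> `|eps j| <= 2 * M.
Proof.
move=> jl; have S0 : 0 < block_Sigma k s j by exact: block_Sigma_gt0 s_gt0 k0 jl.
have Si0 : 0 <= (block_Sigma k s j)^-1 by rewrite invr_ge0 ltW.
have [_ _ _ Mr] := M_rate_bounds s k0 D0 jl.
rewrite /eps /g mulrA -mulrBl normrM [X in _ * X]ger0_norm//.
rewrite (le_trans (ler_wpM2r Si0 (block_sum_approx s jl)))//.
have -> : 2 * D * block_r k s j / block_Sigma k s j =
  2 * (block_r k s j * D / block_Sigma k s j) by ring.
by rewrite ler_pM2l.
Qed.

Let h j := k%:R / n%:R * A / block_Sigma k s j.

Let h_le j : (0 < j <= l)%N -> `|h j| <= K * q / l%:R / block_Sigma k s j.
Proof.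
move=> jl; have S0 : 0 < block_Sigma k s j by exact: block_Sigma_gt0 s_gt0 k0 jl.
have kn' : k%:R / n%:R <= l%:R^-1 :> R.
  rewrite ler_pdivrMr ?ltr0n// ler_pdivlMl ?ltr0n//.
  by rewrite -natrM ler_nat; exact: leq_trunc_div.
have Si0 : 0 <= (block_Sigma k s j)^-1 by rewrite invr_ge0 ltW.
rewrite /h !normrM (ger0_norm Si0) ler_wpM2r//.
rewrite (ger0_norm (ler0n _ _)) (ger0_norm (_ : 0 <= n%:R^-1)) ?invr_ge0//.
by rewrite mulrC ler_pM// mulr_ge0// invr_ge0.
Qed.

(* the cross term in eps uses 2 |g| <= 1 + g^2, whose mean is bounded, and the one in
   h uses the maximum of |g| *)
Let square_bound (j : nat) : (0 < j <= l)%N ->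
  `|(v * g j + eps j - h j) ^+ 2 - v ^+ 2 * g j ^+ 2| <=
  8 * M + 2 * v * M * (1 + g j ^+ 2)
  + 4 * v * K * (Num.sqrt (ln n%:R) * (q / l%:R) * (block_Sigma k s j)^-1)
  + 2 * K ^+ 2 * (q ^+ 2 / l%:R ^+ 2 * (block_Sigma k s j ^+ 2)^-1).
Proof.
move=> jl; have S0 : 0 < block_Sigma k s j by exact: block_Sigma_gt0 s_gt0 k0 jl.
have E := eps_le jl; have H := h_le jl; have G := gauss_max jl.
have M0 : 0 <= M by exact: M_rate_ge0.
have G1 : `|g j| <= 2 * Num.sqrt (ln n%:R).
  rewrite -ler_sqr ?nnegrE ?mulr_ge0 ?sqrtr_ge0// exprMn sqr_sqrtr ?(le_trans ler01)//.
  by rewrite real_normK ?num_real// (le_trans G)//; lra.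
have G2 : 2 * `|g j| <= 1 + g j ^+ 2.
  by have := sqr_ge0 (`|g j| - 1); rewrite sqrrB1 real_normK ?num_real//; lra.
have -> : (v * g j + eps j - h j) ^+ 2 - v ^+ 2 * g j ^+ 2 =
  (eps j - h j) ^+ 2 + 2 * v * g j * eps j - 2 * v * g j * h j by ring.
have T1 : `|(eps j - h j) ^+ 2| <= 8 * M + 2 * (K * q / l%:R / block_Sigma k s j) ^+ 2.
  rewrite ger0_norm ?sqr_ge0//.
  have : eps j ^+ 2 <= (2 * M) ^+ 2.
    by rewrite -(real_normK (num_real (eps j))) ler_sqr ?nnegrE// mulr_ge0.
  have : h j ^+ 2 <= (K * q / l%:R / block_Sigma k s j) ^+ 2.
    rewrite -(real_normK (num_real (h j))) ler_sqr ?nnegrE//.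
    exact: le_trans H.
  have := sqr_ge0 (eps j + h j). have MM : M ^+ 2 <= M by rewrite expr2 ler_piMl. lra.
have T2 : `|2 * v * g j * eps j| <= 2 * v * M * (1 + g j ^+ 2).
  have -> : `|2 * v * g j * eps j| = v * (2 * `|g j| * `|eps j|).
    by rewrite !normrM (ger0_norm v_ge0) (ger0_norm (ler0n _ 2)); ring.
  have -> : 2 * v * M * (1 + g j ^+ 2) = v * ((1 + g j ^+ 2) * (2 * M)) by ring.
  by rewrite ler_wpM2l// ler_pM// mulr_ge0.
have T3 : `|2 * v * g j * h j| <=
    4 * v * K * (Num.sqrt (ln n%:R) * (q / l%:R) * (block_Sigma k s j)^-1).
  have -> : `|2 * v * g j * h j| = 2 * v * (`|g j| * `|h j|).
    by rewrite !normrM (ger0_norm v_ge0) (ger0_norm (ler0n _ 2)); ring.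
  have -> : 4 * v * K * (Num.sqrt (ln n%:R) * (q / l%:R) * (block_Sigma k s j)^-1) =
    2 * v * ((2 * Num.sqrt (ln n%:R)) * (K * q / l%:R / block_Sigma k s j)) by ring.
  by rewrite ler_wpM2l ?mulr_ge0// ler_pM.
have -> : 2 * K ^+ 2 * (q ^+ 2 / l%:R ^+ 2 * (block_Sigma k s j ^+ 2)^-1) =
  2 * (K * q / l%:R / block_Sigma k s j) ^+ 2 by rewrite !exprMn !exprVn; ring.
rewrite (le_trans (ler_normB _ _))// (le_trans (lerD (ler_normD _ _) (lexx _)))//.
lra.
Qed.

(** The normalised recentred block sum is v g + eps - h, with g Gaussian, eps the
    approximation error and h the recentring.  Expanding its square
    and averaging over the blocks, each term is matched with one of the four
    terms of chi_rate. *)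
Lemma good_sums_of_approx :
  good_sums n k s D v (v ^+ 2 * t + (8 + 2 * v * (2 + t)) + 4 * v * K + 2 * K ^+ 2
                       + (8 * v ^+ 2 + 8)) x.
Proof.
have M0 : 0 <= M by exact: M_rate_ge0.
have lnR : 0 <= ln n%:R :> R by rewrite (le_trans ler01).
set C1 := v ^+ 2 * t; set C2 := 8 + _; set C3 := 4 * _ * _; set C4 := 2 * _ ^+ 2.
set C5 := 8 * _ + 8.
have C1_0 : 0 <= C1 by rewrite mulr_ge0// sqr_ge0.
have C2_0 : 0 <= C2 by rewrite addr_ge0// !mulr_ge0// addr_ge0.
have C3_0 : 0 <= C3 by rewrite !mulr_ge0.
have C4_0 : 0 <= C4 by rewrite mulr_ge0// sqr_ge0.
have C5_0 : 0 <= C5 by rewrite addr_ge0// mulr_ge0// sqr_ge0.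
split; last first.
  move=> j jl; have E := eps_le jl; have G := gauss_max jl.
  have -> : block_sum k j (fun i => s i * x i) / block_Sigma k s j = v * g j + eps j.
    by rewrite /eps; ring.
  have E2 : eps j ^+ 2 <= (2 * M) ^+ 2.
    by rewrite -(real_normK (num_real (eps j))) ler_sqr ?nnegrE// mulr_ge0.
  rewrite (le_trans (_ : _ <= C5 * ln n%:R))//; last first.
    by apply: ler_wpM2r => //; lra.
  rewrite (le_trans (_ : _ <= 2 * v ^+ 2 * g j ^+ 2 + 2 * eps j ^+ 2))//.
    by have := sqr_ge0 (v * g j - eps j); lra.
  have v2 : 0 <= 2 * v ^+ 2 by rewrite mulr_ge0// sqr_ge0.
  have := ler_wpM2l v2 G; rewrite /C5.
  have M2 : M ^+ 2 <= 1 by rewrite expr_le1.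
  rewrite exprMn in E2; move: lnn E2.
  move: (g j ^+ 2) (eps j ^+ 2) (ln n%:R) (v ^+ 2) => a b L u *; lra.
pose lR : R := l%:R; rewrite -/l -/lR.
have lR0 : 0 < lR by rewrite ltr0n.
have lV : 0 <= lR^-1 by rewrite invr_ge0 ltW.
pose F j := v * g j + eps j - h j.
have FE j : recentred_block n k s x j / block_Sigma k s j = F j.
  by rewrite /F /eps /h /recentred_block -/A; ring.
rewrite (eq_bigr (fun j => F j ^+ 2)); last by move=> j _; rewrite FE.
have sqrt_l : (Num.sqrt lR)^-1 = Num.sqrt lR / lR.
  rewrite -[X in _ / X]sqr_sqrtr; last exact: ltW.
  rewrite expr2 invfM mulrA mulfV ?mul1r//.
  by rewrite gt_eqF// sqrtr_gt0.
have sqrt_l1 : (Num.sqrt lR)^-1 <= 1.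
  by rewrite invf_le1 ?sqrtr_gt0// -(sqrtr1 R) ler_wsqrtr// ler1n.
have lln : `|lR^-1 * \sum_(1 <= j < l.+1) g j ^+ 2 - 1| <= t * (Num.sqrt lR)^-1.
  have -> : lR^-1 * \sum_(1 <= j < l.+1) g j ^+ 2 - 1 =
      lR^-1 * (\sum_(1 <= j < l.+1) g j ^+ 2 - lR) by rewrite mulrBr mulVf// gt_eqF.
  by rewrite normrM (ger0_norm lV) mulrC sqrt_l mulrA ler_pM2r ?invr_gt0.
have llnM : lR^-1 * \sum_(1 <= j < l.+1) g j ^+ 2 <= 1 + t.
  have : t * (Num.sqrt lR)^-1 <= t * 1 by rewrite ler_wpM2l.
  by have := ler_norm (lR^-1 * \sum_(1 <= j < l.+1) g j ^+ 2 - 1); lra.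
have sum1 : \sum_(1 <= j < l.+1) (1 : R) = lR by rewrite sumr_const_nat subSS subn0.
set T3 := Num.sqrt (ln n%:R) * (total_Sigma n s / l%:R ^+ 2)
            * (\sum_(1 <= j < l.+1) (block_Sigma k s j)^-1).
set T4 := total_Sigma n s ^+ 2 / l%:R ^+ 3
            * (\sum_(1 <= j < l.+1) (block_Sigma k s j ^+ 2)^-1).
have main : `|lR^-1 * \sum_(1 <= j < l.+1) F j ^+ 2 - v ^+ 2| <=
  C1 * (Num.sqrt lR)^-1 + C2 * M + C3 * T3 + C4 * T4.
  have -> : lR^-1 * \sum_(1 <= j < l.+1) F j ^+ 2 - v ^+ 2 =
    lR^-1 * (\sum_(1 <= j < l.+1) (F j ^+ 2 - v ^+ 2 * g j ^+ 2)) +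
    v ^+ 2 * (lR^-1 * \sum_(1 <= j < l.+1) g j ^+ 2 - 1).
    by rewrite sumrB -mulr_sumr; ring.
  rewrite (le_trans (ler_normD _ _))// (normrM lR^-1) (normrM (v ^+ 2)).
  rewrite (ger0_norm (sqr_ge0 v)) (ger0_norm lV).
  have : v ^+ 2 * `|lR^-1 * \sum_(1 <= j < l.+1) g j ^+ 2 - 1| <= C1 * (Num.sqrt lR)^-1.
    by rewrite /C1 -[leRHS]mulrA ler_wpM2l// sqr_ge0.
  have : `|\sum_(1 <= j < l.+1) (F j ^+ 2 - v ^+ 2 * g j ^+ 2)| <=
    8 * M * lR + 2 * v * M * (lR + \sum_(1 <= j < l.+1) g j ^+ 2)
    + C3 * (Num.sqrt (ln n%:R) * (q / lR) * \sum_(1 <= j < l.+1) (block_Sigma k s j)^-1)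
    + C4 * (q ^+ 2 / lR ^+ 2 * \sum_(1 <= j < l.+1) (block_Sigma k s j ^+ 2)^-1).
    rewrite (le_trans (ler_norm_sum _ _ _))//.
    rewrite -{1 2}sum1 !(mulr_sumr, =^~ big_split)/=.
    apply: ler_sum_nat => j jl; rewrite mulr1; exact: square_bound.
  move=> /(ler_wpM2l lV) H1 H2.
  rewrite [leRHS](_ : _ = (C2 * M + C3 * T3 + C4 * T4) + C1 * (Num.sqrt lR)^-1); last by ring.
  rewrite lerD// (le_trans H1)//.
  have -> : lR^-1 * (8 * M * lR + 2 * v * M * (lR + \sum_(1 <= j < l.+1) g j ^+ 2)
    + C3 * (Num.sqrt (ln n%:R) * (q / lR) * \sum_(1 <= j < l.+1) (block_Sigma k s j)^-1)
    + C4 * (q ^+ 2 / lR ^+ 2 * \sum_(1 <= j < l.+1) (block_Sigma k s j ^+ 2)^-1)) =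
    8 * M + 2 * v * M * (1 + lR^-1 * \sum_(1 <= j < l.+1) g j ^+ 2) + C3 * T3 + C4 * T4.
    rewrite /T3 /T4 -/q -/lR; field; rewrite gt_eqF//.
  have -> : C2 * M = 8 * M + 2 * v * M * (2 + t) by rewrite /C2; ring.
  rewrite !lerD2r lerD2l.
  by rewrite ler_wpM2l ?mulr_ge0//; lra.
have [] := chi_rate_bounds k s D n0; rewrite -/l -/lR -/T3 -/T4 -/M => c1 c2 c3 c4.
rewrite (le_trans main)// /chi_rate -/l -/lR -/T3 -/T4 -/M.
set a1 := _^-1 in c1 *; set a2 := ln _ * M in c2 *.
have Ma2 : M <= a2 by rewrite /a2 ler_peMl.
have := ler_wpM2l C2_0 Ma2.
have := mulr_ge0 C1_0 c2; have := mulr_ge0 C1_0 c3; have := mulr_ge0 C1_0 c4.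
have := mulr_ge0 C2_0 c1; have := mulr_ge0 C2_0 c3; have := mulr_ge0 C2_0 c4.
have := mulr_ge0 C3_0 c1; have := mulr_ge0 C3_0 c2; have := mulr_ge0 C3_0 c4.
have := mulr_ge0 C4_0 c1; have := mulr_ge0 C4_0 c2; have := mulr_ge0 C4_0 c3.
have := mulr_ge0 C5_0 c1; have := mulr_ge0 C5_0 c2; have := mulr_ge0 C5_0 c3.
have := mulr_ge0 C5_0 c4; lra.
Qed.

End approximation.
End deterministic.

Section studentised.
Context {R : realType}.
Variables (n k : nat) (s e : nat -> R) (mu : R).
Hypothesis kn : (0 < k <= n)%N.
Hypothesis s_gt0 : forall i, (0 < i <= n)%N -> 0 < s i.

Let X i := mu + s i * e i.
Let A j := block_sum k j (fun i => s i * e i).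
Let k0 : (0 < k)%N. Proof. by case/andP: kn. Qed.
Let n0 : (0 < n)%N. Proof. by case/andP: kn => ? /(leq_trans k0). Qed.
Let kR : k%:R != 0 :> R. Proof. by rewrite pnatr_eq0 -lt0n. Qed.

Lemma block_sum_cst j (c : R) : (0 < j)%N -> block_sum k j (fun=> c) = k%:R * c.
Proof.
move=> j0; rewrite /block_sum sumr_const_nat subSS -mulnBl.
by case: j j0 => // j _; rewrite subSnn mul1n mulr_natl.
Qed.

Lemma block_mean_affine j : (0 < j)%N -> block_mean k X j = mu + A j / k%:R.
Proof.
move=> j0; rewrite /block_mean.
have -> : block_sum k j X = k%:R * mu + A j.
  by rewrite -(block_sum_cst mu j0) /block_sum big_split.
by field.
Qed.

Lemma recentred_blockE j : (0 < j)%N ->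
  k%:R * (block_mean k X j - sample_mean n X) = recentred_block n k s e j.
Proof.
move=> j0; rewrite block_mean_affine// /sample_mean.
have -> : \sum_(1 <= i < n.+1) X i = n%:R * mu + \sum_(1 <= i < n.+1) s i * e i.
  by rewrite big_split/= sumr_const_nat subSS subn0 mulr_natl.
have nR : n%:R != 0 :> R by rewrite pnatr_eq0 -lt0n.
by rewrite /recentred_block -/(A j); field; rewrite kR nR.
Qed.

Lemma block_V_sqr j : (0 < j)%N ->
  block_V k X j ^+ 2 = block_Sigma k s j ^+ 2
    + block_sum k j (fun i => s i ^+ 2 * (e i ^+ 2 - 1)) - A j ^+ 2 / k%:R.
Proof.
move=> j0; rewrite sqr_sqrtr; last by rewrite block_sum_ge0// => i; exact: sqr_ge0.
rewrite block_Sigma_sqr.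
pose m := A j / k%:R.
transitivity (block_sum k j (fun i => s i ^+ 2) +
    block_sum k j (fun i => s i ^+ 2 * (e i ^+ 2 - 1)) +
    - 2 * m * A j + block_sum k j (fun=> m ^+ 2)).
  rewrite [A j in RHS]/A /block_sum [- 2 * m * _]mulr_sumr -!big_split/=.
  by apply: eq_bigr => i _; rewrite block_mean_affine// -/m /X; ring.
by rewrite block_sum_cst// /m; field.
Qed.

Lemma block_D_sqr j : (0 < j)%N ->
  block_D n k X j ^+ 2 = recentred_block n k s e j ^+ 2 / block_V k X j ^+ 2.
Proof. by move=> j0; rewrite /block_D recentred_blockE// exprMn exprVn. Qed.

Variables (D v C1 C2 : R).
Hypothesis D_ge0 : 0 <= D.
Hypothesis lnn : 1 <= ln n%:R :> R.
Hypothesis C1_ge0 : 0 <= C1.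
Hypothesis C2_ge0 : 0 <= C2.
Let chi := chi_rate n k s D.
Hypothesis chi_le1 : chi <= 1.
Hypothesis chi_small : (C1 + C2) * chi <= 2^-1.
Hypothesis sums : good_sums n k s D v C1 e.
Hypothesis squares : good_squares n k s D C2 (fun i => e i ^+ 2 - 1).

Let U j := recentred_block n k s e j / block_Sigma k s j.

(** If V^2 = Sigma^2 (1 + b) with |b| <= 1/2, then |1 / (1 + b) - 1| <= 2 |b|. *)
Lemma block_D_sqr_close j : (0 < j <= nblocks n k)%N ->
  `|block_D n k X j ^+ 2 - U j ^+ 2| <= 2 * ((C1 + C2) * chi) * U j ^+ 2.
Proof.
move=> jl; have /andP[j0 jle] := jl.
have S0 : 0 < block_Sigma k s j by exact: block_Sigma_gt0 s_gt0 k0 jl.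
have S2 : 0 < block_Sigma k s j ^+ 2 by rewrite exprn_gt0.
pose b := (block_sum k j (fun i => s i ^+ 2 * (e i ^+ 2 - 1)) - A j ^+ 2 / k%:R)
  / block_Sigma k s j ^+ 2.
have VE : block_V k X j ^+ 2 = block_Sigma k s j ^+ 2 * (1 + b).
  by rewrite block_V_sqr// /b; field; rewrite gt_eqF.
have [a1 a2 a3 a4] := chi_rate_bounds k s D n0.
have Mchi : ln n%:R * M_rate n k s D <= chi.
  by rewrite /chi /chi_rate; lra.
have [kM _ _ _] := M_rate_bounds s k0 D_ge0 jl.
have lnR : 0 <= ln n%:R :> R by rewrite (le_trans ler01).
have ble : `|b| <= (C1 + C2) * chi.
  rewrite /b mulrBl (le_trans (ler_normB _ _))// normrM [X in _ * X + _]ger0_norm; last first.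
    by rewrite invr_ge0 ltW.
  rewrite addrC mulrDl lerD//; last first.
    by rewrite (le_trans (squares jl))// ler_wpM2l.
  rewrite ger0_norm; last first.
    by rewrite !divr_ge0 ?sqr_ge0.
  have -> : A j ^+ 2 / k%:R / block_Sigma k s j ^+ 2 = (A j / block_Sigma k s j) ^+ 2 * k%:R^-1.
    by rewrite exprMn exprVn mulrAC.
  rewrite (le_trans (_ : _ <= C1 * ln n%:R * M_rate n k s D))//.
    by apply: ler_pM => //; [exact: sqr_ge0|case: sums => _ /(_ _ jl)].
  by rewrite -mulrA ler_wpM2l.
have bh : `|b| <= 2^-1 := le_trans ble chi_small.
have b1 : 0 < 1 + b by have := ler_norm (- b); rewrite normrN; lra.
have -> : block_D n k X j ^+ 2 - U j ^+ 2 = - (b / (1 + b)) * U j ^+ 2.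
  by rewrite block_D_sqr// VE /U; field; rewrite !gt_eqF.
rewrite normrM [X in _ * X <= _]ger0_norm ?sqr_ge0// ler_wpM2r ?sqr_ge0//.
rewrite normrN normrM [X in _ * X]ger0_norm; last by rewrite invr_ge0 ltW.
rewrite ler_pdivrMr//.
have b2 : 2^-1 <= 1 + b by have := ler_norm (- b); rewrite normrN; lra.
have c0 : 0 <= 2 * ((C1 + C2) * chi) by rewrite mulr_ge0// (le_trans _ ble).
have := ler_wpM2l c0 b2; move: ble c0.
move: ((C1 + C2) * chi) `|b| (1 + b) => c x y; lra.
Qed.

Lemma tau2_hat_close :
  `|tau2_hat n k X - v ^+ 2| <= (C1 + 2 * (C1 + C2) * (v ^+ 2 + C1)) * chi.
Proof.
have chi0 : 0 <= chi by exact: chi_rate_ge0.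
have [Qv _] := sums; rewrite -/chi in Qv.
set l := nblocks n k in Qv *.
have lV : 0 <= l%:R^-1 :> R by rewrite invr_ge0.
pose Q := l%:R^-1 * \sum_(1 <= j < l.+1) U j ^+ 2.
have Qle : Q <= v ^+ 2 + C1.
  have := le_trans (ler_norm _) Qv; rewrite -/Q => H.
  have := ler_wpM2l C1_ge0 chi_le1; rewrite mulr1 => H1.
  have : Q - v ^+ 2 <= C1 * chi by exact: H.
  by lra.
have -> : tau2_hat n k X - v ^+ 2 =
    (tau2_hat n k X - Q) + (Q - v ^+ 2) by ring.
rewrite (le_trans (ler_normD _ _))// mulrDl addrC lerD//.
rewrite /tau2_hat -/l /Q -mulrBr -sumrB normrM ger0_norm//.
rewrite (le_trans (_ : _ <= l%:R^-1 * \sum_(1 <= j < l.+1) (2 * ((C1 + C2) * chi) * U j ^+ 2)))//.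
  rewrite ler_wpM2l// (le_trans (ler_norm_sum _ _ _))//.
  by apply: ler_sum_nat => j jl; exact: block_D_sqr_close.
rewrite -mulr_sumr mulrCA -/Q.
have c0 : 0 <= 2 * ((C1 + C2) * chi) by rewrite !mulr_ge0// addr_ge0.
rewrite (le_trans (ler_wpM2l c0 Qle))//.
by rewrite le_eqVlt; apply/orP; left; apply/eqP; ring.
Qed.

End studentised.

(** * Measurability and transfer between spaces *)

Section measurability.
Context d (T : measurableType d) (R : realType).
Implicit Types (x : nat -> T -> R) (s : nat -> R) (n k j : nat).

Lemma measurable_sum_nat x s a b : (forall i, measurable_fun setT (x i)) ->
  measurable_fun setT (fun w => \sum_(a <= i < b) s i * x i w).
Proof. by move=> mx; apply: measurable_sum => i; exact: measurable_funM. Qed.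

Lemma measurable_block_ratio x s k j (c : R) : (forall i, measurable_fun setT (x i)) ->
  measurable_fun setT (fun w => block_sum k j (fun i => s i * x i w) / c).
Proof. by move=> mx; apply: measurable_funM => //; exact: measurable_sum_nat. Qed.

Lemma measurable_recentred_block x s n k j : (forall i, measurable_fun setT (x i)) ->
  measurable_fun setT (fun w => recentred_block n k s (fun i => x i w) j).
Proof.
move=> mx; apply: measurable_funB; first exact: measurable_sum_nat.
by apply: measurable_funM => //; exact: measurable_sum_nat.
Qed.

Lemma measurable_ge (f : T -> R) (c : R) : measurable_fun setT f ->
  measurable [set w | f w <= c].
Proof.
move=> mf; rewrite (_ : [set w | _] = f @^-1` `]-oo, c]%classic).
  by rewrite -[X in measurable X]setTI; exact: mf.
by apply/seteqP; split => w /=; rewrite in_itv.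
Qed.

Lemma measurable_forall_block l (F : nat -> T -> R) (c : R) :
  (forall j, measurable_fun setT (F j)) ->
  measurable [set w | forall j, (0 < j <= l)%N -> F j w <= c].
Proof.
move=> mF; rewrite (_ : [set w | _] =
    \bigcap_(j in [set j | (0 < j <= l)%N]) [set w | F j w <= c]); last first.
  by apply/seteqP; split.
by apply: bigcap_measurableType => j _; exact: measurable_ge.
Qed.

Lemma measurable_good_sums x s n k (D v C : R) : (forall i, measurable_fun setT (x i)) ->
  measurable [set w | good_sums n k s D v C (fun i => x i w)].
Proof.
move=> mx; rewrite /good_sums; apply: measurableI.
  apply: measurable_ge; apply: measurableT_comp => //; apply: measurable_funB => //.
  apply: measurable_funM => //; apply: measurable_sum => j.
  apply: measurable_funX; apply: measurable_funM => //.
  exact: measurable_recentred_block.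
apply: measurable_forall_block => j; apply: measurable_funX.
exact: measurable_block_ratio.
Qed.

Lemma measurable_good_squares x s n k (D C : R) : (forall i, measurable_fun setT (x i)) ->
  measurable [set w | good_squares n k s D C (fun i => x i w)].
Proof.
move=> mx; apply: measurable_forall_block => j.
apply: measurable_funM => //; apply: measurableT_comp => //.
exact: (@measurable_sum_nat x (fun i => s i ^+ 2)).
Qed.

Lemma measurable_sqrt_comp (f : T -> R) : measurable_fun setT f ->
  measurable_fun setT (fun w => Num.sqrt (f w)).
Proof.
move=> mf; apply: (measurableT_comp _ mf).
by apply: continuous_measurable_fun; exact: sqrt_continuous.
Qed.

Lemma measurable_tau2_hat (X : T -> nat -> R) n k : (forall i, measurable_fun setT (X ^~ i)) ->
  measurable_fun setT (fun w => tau2_hat n k (X w)).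
Proof.
move=> mX; have mmean j : measurable_fun setT (fun w => block_mean k (X w) j).
  by apply: measurable_funM => //; exact: measurable_sum.
apply: measurable_funM => //; apply: measurable_sum => j; apply: measurable_funX.
apply: measurable_funM.
  apply: measurable_funM => //; apply: measurable_funB => //.
  by apply: measurable_funM => //; exact: measurable_sum.
rewrite (_ : (fun w => _) = (fun w => block_V k (X w) j `^ (-1))); last first.
  by apply/funext => w; rewrite powR_inv1// sqrtr_ge0.
apply: (@measurableT_comp _ _ _ _ _ _ (@powR R ^~ (-1))) => //.
apply: measurable_sqrt_comp; apply: measurable_sum => i.
by apply: measurable_funX; exact: measurable_funB.
Qed.

End measurability.

Section transfer.
Context {R : realType}.
Implicit Types (s : nat -> R) (n k : nat).

Lemma measurable_tuple_nth n i : measurable_fun setT (fun v : n.-tuple R => nth 0 v i).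
Proof.
have [ni|ni] := leqP n i.
  rewrite (_ : (fun v => _) = cst 0); first exact: measurable_cst.
  by apply/funext => v; rewrite nth_default// size_tuple.
rewrite (_ : (fun v => _) = (fun v => tnth v (Ordinal ni))).
  exact: measurable_tnth.
by apply/funext => v; rewrite (tnth_nth 0).
Qed.

(** An event that is measurable for every process, and depends only on the values
    at 1, ..., n, is the preimage under the window of a measurable set of
    n-tuples.  The value at index 0, which the law does not see, is read as a
    default value on the side of tuples. *)
Lemma same_law_event d (T : measurableType d) (P : probability T R) x
    d' (T' : measurableType d') (P' : probability T' R) y n (G : set (nat -> R)) :
  same_law P x P' y ->
  (forall d0 (T0 : measurableType d0) (z : nat -> T0 -> R),
     (forall i, measurable_fun setT (z i)) -> measurable [set w | G (fun i => z i w)]) ->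
  (forall a b, (forall i, (0 < i <= n)%N -> a i = b i) -> G a -> G b) ->
  P [set w | G (fun i => x i w)] = P' [set w | G (fun i => y i w)].
Proof.
move=> law mG extG.
pose A := [set v : n.-tuple R | G (fun i => nth 0 v i.-1)].
have mA : measurable A by apply: mG => i; exact: measurable_tuple_nth.
have pre d0 (T0 : measurableType d0) (z : nat -> T0 -> R) :
    [set w | G (fun i => z i w)] = window z 0 n @^-1` A.
  have E w i : (0 < i <= n)%N -> nth 0 (window z 0 n w) i.-1 = z i w.
    case: i => // i; rewrite /= => ni.
    transitivity (tnth (window z 0 n w) (Ordinal ni)); first by rewrite (tnth_nth 0).
    by rewrite tnth_mktuple.
  by apply/seteqP; split => w; apply: extG => i ni; rewrite E.
by rewrite !pre; exact: law.
Qed.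

Lemma eq_block_sum k j n (F G : nat -> R) : (j <= nblocks n k)%N ->
  (forall i, (0 < i <= n)%N -> F i = G i) -> block_sum k j F = block_sum k j G.
Proof.
move=> jl FG; apply: eq_big_nat => i /andP[ji ij]; apply: FG.
by rewrite (leq_ltn_trans _ ji)//= (leq_trans _ (block_le jl)).
Qed.

Lemma eq_good_sums n k s (D v C : R) (a b : nat -> R) :
  (forall i, (0 < i <= n)%N -> a i = b i) ->
  good_sums n k s D v C a -> good_sums n k s D v C b.
Proof.
move=> ab.
have Sab j : (j <= nblocks n k)%N ->
    block_sum k j (fun i => s i * a i) = block_sum k j (fun i => s i * b i).
  by move=> jl; apply: (eq_block_sum jl) => i /ab ->.
have Tab : \sum_(1 <= i < n.+1) s i * a i = \sum_(1 <= i < n.+1) s i * b i.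
  by apply: eq_big_nat => i ni; rewrite ab.
move=> [H1 H2]; split.
  rewrite (eq_big_nat _ _ (F2 := fun j => (recentred_block n k s a j / block_Sigma k s j) ^+ 2))//.
  by move=> j /andP[_ jl]; rewrite /recentred_block Tab Sab.
by move=> j /[dup] /andP[_ jl] /H2; rewrite Sab.
Qed.

Lemma eq_good_squares n k s (D C : R) (a b : nat -> R) :
  (forall i, (0 < i <= n)%N -> a i = b i) ->
  good_squares n k s D C a -> good_squares n k s D C b.
Proof.
move=> ab H j /[dup] /andP[_ jl] /H.
by rewrite (eq_block_sum jl (G := fun i => s i ^+ 2 * b i))// => i /ab ->.
Qed.

End transfer.

(** * Rate of convergence and consistency *)

Section in_probability.
Context {R : realType}.

Lemma near_ln_ge1 : \forall n \near \oo, 1 <= ln n%:R :> R.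
Proof.
near=> n; have nE : expR 1 <= n%:R :> R by near: n; exact: nbhs_infty_ger.
by rewrite -[leLHS]expRK ler_ln// posrE ?expR_gt0// (lt_le_trans _ nE)// expR_gt0.
Unshelve. all: by end_near. Qed.

Lemma sip_rate_gt0 n : (2 <= n)%N -> 0 < sip_rate n :> R.
Proof.
move=> n2; rewrite mulr_gt0// ?powR_gt0 ?ltr0n ?(leq_trans _ n2)//.
by rewrite ln_gt0// ltr1n.
Qed.

Lemma sip_rate_ge0 n : (0 < n)%N -> 0 <= sip_rate n :> R.
Proof. by move=> n0; rewrite mulr_ge0 ?powR_ge0// ln_ge0// ler1n. Qed.

Lemma probability_le_cover d (T : measurableType d) (P : probability T R)
    (S A B : set T) (a b : R) :
  measurable S -> measurable A -> measurable B ->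
  (forall w, ~ A w -> ~ B w -> ~ S w) ->
  (P A <= a%:E)%E -> (P B <= b%:E)%E -> (P S <= (a + b)%:E)%E.
Proof.
move=> mS mA mB SAB PA PB.
have SU : S `<=` A `|` B.
  move=> w Sw; apply: contrapT => /not_orP[nA nB]; exact: SAB Sw.
apply: (@le_trans _ _ (P (A `|` B))).
  by apply: le_measure; rewrite ?inE//; exact: measurableU.
by apply: le_trans (measureU2 P mA mB) _; rewrite EFinD leeD.
Qed.

(** The copy of the process is measurable at positive indices only; its value at
    index 0 is replaced by 0. *)
Lemma measurable_process_event d (T : measurableType d) (y : nat -> T -> R) n
    (G : set (nat -> R)) :
  (forall i, (0 < i)%N -> measurable_fun setT (y i)) ->
  (forall d0 (T0 : measurableType d0) (z : nat -> T0 -> R),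
     (forall i, measurable_fun setT (z i)) -> measurable [set w | G (fun i => z i w)]) ->
  (forall a b, (forall i, (0 < i <= n)%N -> a i = b i) -> G a -> G b) ->
  measurable [set w | G (fun i => y i w)].
Proof.
move=> my mG extG; pose y' i := if (0 < i)%N then y i else cst 0.
have -> : [set w | G (fun i => y i w)] = [set w | G (fun i => y' i w)].
  by apply/seteqP; split => w; apply: extG => i /andP[i0 _]; rewrite /y' i0.
by apply: mG => i; rewrite /y'; case: ifP => [/my//|_]; exact: measurable_cst.
Qed.

Section sip.
Context d (T : measurableType d) (P : probability T R).
Variables (x : nat -> T -> R) (v : R) (k : nat -> nat) (s : nat -> nat -> R).
Hypothesis sip : strong_invariance_principle P x v (fun n => sip_rate n).
Hypothesis v_ge0 : 0 <= v.
Hypothesis kn : forall n, (0 < n)%N -> (0 < k n <= n)%N.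
Hypothesis s_gt0 : forall n i, (0 < i <= n)%N -> 0 < s n i.

(** The constant does not depend on eps, because the approximation and the maximum
    of the Gaussian block sums are controlled with probability tending to 1. *)
Lemma good_squares_in_probability (eps : R) : 0 < eps ->
  \forall n \near \oo,
    (P [set w | ~ good_squares n (k n) (s n) (sip_rate n) (2 * v + 2) (fun i => x i w)]
       <= eps%:E)%E.
Proof.
move=> eps0; have e2 : 0 < eps / 2 by rewrite divr_gt0.
have [d' [T' [P' [y [B [my law brownB sipB]]]]]] := sip.
have [E1 [mE1 PE1 [N1 _ good1]]] := sip_uniform_event my brownB sipB sip_rate_gt0 e2.
have [t t0 [N2 _ good2]] := gaussian_blocks_event (brownian_increments_gaussian brownB) e2.
near=> n.
have n1 : (0 < n)%N by near: n; exact: nbhs_infty_ge.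
have nN1 : (N1 <= n)%N by near: n; exact: nbhs_infty_ge.
have nN2 : (N2 <= n)%N by near: n; exact: nbhs_infty_ge.
have lnn : 1 <= ln n%:R :> R by near: n; exact: near_ln_ge1.
have sn2 i : (0 < i <= n)%N -> 0 < s n i ^+ 2 by move=> /s_gt0 ?; rewrite exprn_gt0.
have [E2 [mE2 PE2 {}good2]] := good2 n nN2 _ _ (kn n1) sn2.
have {}good1 := good1 n nN1.
pose G := [set a | ~ good_squares n (k n) (s n) (sip_rate n) (2 * v + 2) a].
have mG d0 (T0 : measurableType d0) (z : nat -> T0 -> R) :
    (forall i, measurable_fun setT (z i)) -> measurable [set w | G (fun i => z i w)].
  by move=> mz; apply: measurableC; exact: measurable_good_squares.
have extG a b : (forall i, (0 < i <= n)%N -> a i = b i) -> G a -> G b.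
  by move=> ab Ga Gb; apply: Ga; apply: eq_good_squares Gb => i /ab.
rewrite -/(G _) (same_law_event law mG extG) (splitr eps).
apply: probability_le_cover PE1 PE2 => //; first exact: measurable_process_event extG.
move=> w nE1 nE2 /=; apply.
have [_ _ gmax] := good2 w nE2.
exact: (good_squares_of_approx (kn n1) (@s_gt0 n) v_ge0 lnn (good1 w nE1)).
Unshelve. all: by end_near. Qed.

Hypothesis total_r_le1 :
  \forall n \near \oo, total_r n (s n) * sip_rate n / total_Sigma n (s n) <= 1.
Hypothesis M_le1 : \forall n \near \oo, M_rate n (k n) (s n) (sip_rate n) <= 1.

(** Unlike above, C grows as eps decreases: the normalised total and the fluctuation
    of the sum of the squares are merely bounded in probability. *)
Lemma good_sums_in_probability (eps : R) : 0 < eps ->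
  exists2 C, 0 <= C & \forall n \near \oo,
    (P [set w | ~ good_sums n (k n) (s n) (sip_rate n) v C (fun i => x i w)]
       <= eps%:E)%E.
Proof.
move=> eps0; have e2 : 0 < eps / 2 by rewrite divr_gt0.
have [d' [T' [P' [y [B [my law brownB sipB]]]]]] := sip.
have [E1 [mE1 PE1 [N1 _ good1]]] := sip_uniform_event my brownB sipB sip_rate_gt0 e2.
have [t t0 [N2 _ good2]] := gaussian_blocks_event (brownian_increments_gaussian brownB) e2.
have t_ge0 := ltW t0.
pose C := v ^+ 2 * t + (8 + 2 * v * (2 + t)) + 4 * v * (v * t + 2) + 2 * (v * t + 2) ^+ 2
                       + (8 * v ^+ 2 + 8).
have C0 : 0 <= C.
  by rewrite /C !(addr_ge0, mulr_ge0, sqr_ge0).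
exists C => //; near=> n.
have n1 : (0 < n)%N by near: n; exact: nbhs_infty_ge.
have nN1 : (N1 <= n)%N by near: n; exact: nbhs_infty_ge.
have nN2 : (N2 <= n)%N by near: n; exact: nbhs_infty_ge.
have lnn : 1 <= ln n%:R :> R by near: n; exact: near_ln_ge1.
have rn : total_r n (s n) * sip_rate n / total_Sigma n (s n) <= 1 by near: n.
have Mn : M_rate n (k n) (s n) (sip_rate n) <= 1 by near: n.
have [E2 [mE2 PE2 {}good2]] := good2 n nN2 _ _ (kn n1) (@s_gt0 n).
have {}good1 := good1 n nN1.
pose G := [set a | ~ good_sums n (k n) (s n) (sip_rate n) v C a].
have mG d0 (T0 : measurableType d0) (z : nat -> T0 -> R) :
    (forall i, measurable_fun setT (z i)) -> measurable [set w | G (fun i => z i w)].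
  by move=> mz; apply: measurableC; exact: measurable_good_sums.
have extG a b : (forall i, (0 < i <= n)%N -> a i = b i) -> G a -> G b.
  by move=> ab Ga Gb; apply: Ga; apply: eq_good_sums Gb => i /ab.
rewrite -/(G _) (same_law_event law mG extG) (splitr eps).
apply: probability_le_cover PE1 PE2 => //; first exact: measurable_process_event extG.
move=> w nE1 nE2 /=; apply.
have [glln gtot gmax] := good2 w nE2.
exact: (good_sums_of_approx (kn n1) (@s_gt0 n) v_ge0 lnn (good1 w nE1) Mn t_ge0 glln gtot gmax rn).
Unshelve. all: by end_near. Qed.

End sip.
End in_probability.

Lemma tau2_hat_ge0 (R : realType) n k (X : nat -> R) : 0 <= tau2_hat n k X.
Proof. by rewrite mulr_ge0 ?invr_ge0//; apply: sumr_ge0 => j _; exact: sqr_ge0. Qed.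

Theorem theorem2p4 (R : realType) (d : measure_display) (T : measurableType d)
    (P : probability T R) (e : nat -> {RV P >-> R}) (mu : R)
    (sigma : nat -> nat -> R) (tau taus : R) (k : nat -> nat) :
  let estar := fun (i : nat) (w : T) => e i w ^+ 2 - 1 in
  let X := fun (n : nat) (w : T) (i : nat) => mu + sigma n i * e i w in
  let Delta := fun n : nat => sip_rate n in
  let chi := fun n : nat => chi_rate n (k n) (sigma n) (Delta n) in
  strictly_stationary P (fun i => e i) ->
  (forall i, (0 < i)%N -> ('E_P[e i] = 0)%E) ->
  (forall i, (0 < i)%N -> ('E_P[fun w => (e i w ^+ 2)%R] = 1)%E) ->
  0 < tau -> has_long_run_variance P (fun i => e i) (tau ^+ 2) ->
  0 <= taus -> has_long_run_variance P estar (taus ^+ 2) ->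
  (forall n i, (0 < i <= n)%N -> 0 < sigma n i) ->
  strong_invariance_principle P (fun i => e i) tau Delta ->
  strong_invariance_principle P estar taus Delta ->
  (forall n, (0 < n)%N -> (0 < k n <= n)%N) ->
  (fun n => total_r n (sigma n) * Delta n / total_Sigma n (sigma n))
    @ \oo --> (0 : R) ->
  chi @ \oo --> (0 : R) ->
  bounded_in_probability P
    (fun n w => tau2_hat n (k n) (X n w) - tau ^+ 2) chi /\
  cvg_in_probability P (fun n w => tau_hat n (k n) (X n w)) tau.
Proof.
move=> estar X Delta chi _ _ _ tau0 _ taus0 _ sigma0 sip sips kn r0 chi0.
have tau_ge0 := ltW tau0.
have mX n i : measurable_fun setT (fun w => X n w i).
  by apply: measurable_funD => //; apply: measurable_funM.
have mtau2 n : measurable_fun setT (fun w => tau2_hat n (k n) (X n w)).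
  exact: measurable_tau2_hat.
have mdev n c : measurable [set w | c < `|tau2_hat n (k n) (X n w) - tau ^+ 2|].
  rewrite (_ : [set w | _] = ~` [set w | `|tau2_hat n (k n) (X n w) - tau ^+ 2| <= c]).
    apply: measurableC; apply: measurable_ge; apply: measurableT_comp => //.
    exact: measurable_funB.
  by apply/seteqP; split => w /=; rewrite ltNge => /negP.
have total_r_le1 : \forall n \near \oo,
    total_r n (sigma n) * sip_rate n / total_Sigma n (sigma n) <= 1.
  exact: (cvgr_le 0 r0 1 ltr01).
have chi_le1 : \forall n \near \oo, chi n <= 1 by exact: (cvgr_le 0 chi0 1 ltr01).
(* M_n <= log(n) M_n <= chi_n as soon as log n >= 1 *)
have M_le1 : \forall n \near \oo, M_rate n (k n) (sigma n) (sip_rate n) <= 1.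
  near=> n.
  have n1 : (0 < n)%N by near: n; exact: nbhs_infty_ge.
  have lnn : 1 <= ln n%:R :> R by near: n; exact: near_ln_ge1.
  have [a1 a2 a3 a4] := chi_rate_bounds (k n) (sigma n) (sip_rate n) n1.
  have : chi n <= 1 by near: n.
  rewrite /chi /chi_rate -/(Delta n) => c1.
  rewrite (le_trans (_ : _ <= ln n%:R * M_rate n (k n) (sigma n) (sip_rate n)))//.
    by rewrite ler_peMl// M_rate_ge0.
  by move: a1 a2 a3 a4 c1; rewrite /Delta; lra.
have bounded : bounded_in_probability P
    (fun n w => tau2_hat n (k n) (X n w) - tau ^+ 2) chi.
  move=> eps eps0; have e2 : 0 < eps / 2 by rewrite divr_gt0.
  have [C1 C1_ge0 [N1 _ sums_ev]] :=
    good_sums_in_probability sip tau_ge0 kn sigma0 total_r_le1 M_le1 e2.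
  have [N2 _ squares_ev] := good_squares_in_probability sips taus0 kn sigma0 e2.
  pose C2 := 2 * taus + 2; have C2_gt0 : 0 < C2 by rewrite ltr_wpDl// mulr_ge0.
  pose C := C1 + 2 * (C1 + C2) * (tau ^+ 2 + C1).
  have C0 : 0 < C.
    have : 0 < 2 * (C1 + C2) * (tau ^+ 2 + C1).
      have CC : 0 < C1 + C2 by rewrite ltr_wpDl.
      have tC : 0 < tau ^+ 2 + C1 by rewrite ltr_pwDl// exprn_gt0.
      by rewrite !mulr_gt0.
    by move=> H; rewrite /C ltr_wpDl.
  exists C; split => //.
  have chi_small : \forall n \near \oo, chi n <= 2^-1 / (C1 + C2).
    by apply: (cvgr_le 0 chi0); rewrite divr_gt0// ltr_wpDl.
  near=> n.
  have n1 : (0 < n)%N by near: n; exact: nbhs_infty_ge.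
  have lnn : 1 <= ln n%:R :> R by near: n; exact: near_ln_ge1.
  have nN1 : (N1 <= n)%N by near: n; exact: nbhs_infty_ge.
  have nN2 : (N2 <= n)%N by near: n; exact: nbhs_infty_ge.
  have c1 : chi n <= 1 by near: n.
  have c2 : (C1 + C2) * chi n <= 2^-1.
    rewrite mulrC -ler_pdivlMr; last by rewrite ltr_wpDl.
    by near: n.
  rewrite (splitr eps).
  apply: (probability_le_cover _ _ _ _ (sums_ev n nN1) (squares_ev n nN2)) => //.
  - by apply: measurableC; exact: measurable_good_sums.
  - apply: measurableC; apply: measurable_good_squares => i.
    by apply: measurable_funB => //; exact: measurable_funX.
  - move=> w /contrapT sums /contrapT squares /=.
    apply/negP; rewrite -leNgt (ger0_norm (chi_rate_ge0 (k n) (sigma n) (Delta n) n1)).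
    exact: (tau2_hat_close mu (kn n n1) (@sigma0 n) (sip_rate_ge0 n1) lnn
              C1_ge0 (ltW C2_gt0) c1 c2 sums squares).
split => // eps eps0.
have mtau n : measurable [set w | eps < `|tau_hat n (k n) (X n w) - tau|].
  rewrite (_ : [set w | _] = ~` [set w | `|tau_hat n (k n) (X n w) - tau| <= eps]).
    apply: measurableC; apply: measurable_ge; apply: measurableT_comp => //.
    by apply: measurable_funB => //; exact: measurable_sqrt_comp.
  by apply/seteqP; split => w /=; rewrite ltNge => /negP.
apply/fine_cvgP; split.
  by apply: nearW => n; rewrite fin_num_measure.
apply/cvgrPdist_le => delta delta0.
have [C [C0 [N _ HN]]] := bounded delta delta0.
have chi_small : \forall n \near \oo, chi n <= eps * tau / C.
  by apply: (cvgr_le 0 chi0); rewrite divr_gt0// mulr_gt0.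
near=> n.
have nN : (N <= n)%N by near: n; exact: nbhs_infty_ge.
have n1 : (0 < n)%N by near: n; exact: nbhs_infty_ge.
have chin : C * `|chi n| <= eps * tau.
  rewrite ger0_norm ?chi_rate_ge0// mulrC -ler_pdivlMr//; near: n.
  exact: chi_small.
rewrite sub0r normrN /= ger0_norm ?fine_ge0//.
rewrite -lee_fin fineK ?fin_num_measure//.
apply: le_trans (HN n nN); apply: le_measure; rewrite ?inE//.
move=> w /= Hw; rewrite (le_lt_trans chin)//.
have tau2E : tau2_hat n (k n) (X n w) = tau_hat n (k n) (X n w) ^+ 2.
  by rewrite sqr_sqrtr// tau2_hat_ge0.
rewrite tau2E subr_sqr normrM.
have th0 : 0 <= tau_hat n (k n) (X n w) by exact: sqrtr_ge0.
rewrite [X in _ < _ * X]ger0_norm ?addr_ge0//.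
apply: (lt_le_trans (_ : _ < `|tau_hat n (k n) (X n w) - tau| * tau)).
  by rewrite ltr_pM2r.
by rewrite ler_wpM2l// lerDr.
Unshelve. all: by end_near. Qed.
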